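(* Under the standing assumptions below, let $\bar x$ be a stationary point of (P) at which MSCQ holds. Consider: (i) $\bar x$ is a local minimizer of (P); (ii) $\langle z,w\rangle\ge0$ for all $w\in\operatorname{dom}D(\partial f)(\bar x|0)$ and all $z\in D(\partial f)(\bar x|0)(w)$; (iii) for each $w\in\operatorname{dom}D(\partial f)(\bar x|0)$ there exists $z\in D(\partial f)(\bar x|0)(w)$ with $\langle z,w\rangle\ge0$; (iv) for each $w\in\overline K$, $\max\{w^T\nabla^2_xL(\bar x,\lambda)w+w^T\widetilde{\mathcal H}_\lambda w\mid \lambda\in\Lambda(\bar x)\}\ge0$. Then (i) $\Rightarrow$ (ii) $\Leftrightarrow$ (iii) $\Leftrightarrow$ (iv).
   Context: Problem (P): minimize $g(x)$ subject to $q(x)\in\Theta$, where $g:\mathbb{R}^n\to\mathbb{R}$, $q:\mathbb{R}^n\to\mathbb{R}^m$ are $C^2$ and $\Theta\subset\mathbb{R}^m$ is nonempty closed convex; $\Gamma=\{x\mid q(x)\in\Theta\}$, $f=g+\delta_\Gamma$ ($\delta_\Gamma$ the indicator of $\Gamma$), $\bar x\in\Gamma$, $\bar y=q(\bar x)$. $\Theta$ is $C^2$-cone reducible at $\bar y$ to a pointed closed convex cone $C\subset\mathbb{R}^l$: there are a neighborhood $V$ of $\bar y$ and a $C^2$ map $h:V\to\mathbb{R}^l$ with $h(\bar y)=0$, $\nabla h(\bar y)$ surjective, $\Theta\cap V=\{y\in V\mid h(y)\in C\}$. MSCQ at $\bar x$: $d(x;\Gamma)\le\kappa\,d(q(x);\Theta)$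 for all $x$ near $\bar x$, for some $\kappa>0$. $\Lambda(\bar x)=\{\lambda\in N_\Theta(\bar y)\mid \nabla g(\bar x)+\nabla q(\bar x)^T\lambda=0\}$ (convex normal cone), and $\bar x$ is stationary if $\Lambda(\bar x)\ne\emptyset$. $L(x,\lambda)=g(x)+\langle\lambda,q(x)\rangle$. Critical cone $\overline K=T_\Gamma(\bar x)\cap\{\nabla g(\bar x)\}^\perp$. For $\lambda\in\Lambda(\bar x)$, let $\mu_\lambda$ be the unique vector with $\nabla h(\bar y)^T\mu_\lambda=\lambda$ (written $(\nabla h(\bar y)^* )^{-1}(\lambda)$), and $\widetilde{\mathcal H}_\lambda=\nabla q(\bar x)^T\,\nabla^2\langle\mu_\lambda,h(\cdot)\rangle(\bar y)\,\nabla q(\bar x)$. $\partial f$ is the limiting subdifferential, and $D(\partial f)(\bar x|0)(w)=\{z\mid (w,z)\in T_{\operatorname{gph}\partial f}(\bar x,0)\}$ with $T$ the contingent cone $T_\Omega(\bar u)=\{v\mid\exists t_k\downarrow0,v_k\to v,\bar u+t_kv_k\in\Omega\}$. *)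

(* Defs.v *)
From Stdlib Require Import Reals ClassicalEpsilon.
From mathcomp Require Import ssreflect ssrbool ssrfun eqtype ssrnat seq fintype bigop.

Local Open Scope R_scope.

Definition Vec (n : nat) := 'I_n -> R.
Definition Mat (m n : nat) := 'I_m -> 'I_n -> R.

Definition vsum {n : nat} (F : 'I_n -> R) : R := \big[Rplus/0]_(i < n) F i.
Definition vzero {n : nat} : Vec n := fun _ => 0.
Definition vadd {n : nat} (x y : Vec n) : Vec n := fun i => x i + y i.
Definition vsub {n : nat} (x y : Vec n) : Vec n := fun i => x i - y i.
Definition vopp {n : nat} (x : Vec n) : Vec n := fun i => - x i.
Definition vscale {n : nat} (t : R) (x : Vec n) : Vec n := fun i => t * x i.
Definition dot {n : nat} (x y : Vec n) : R := vsum (fun i => x i * y i).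
Definition vnorm {n : nat} (x : Vec n) : R := sqrt (dot x x).
Definition mv {m n : nat} (A : Mat m n) (u : Vec n) : Vec m :=
  fun i => vsum (fun j => A i j * u j).
Definition mtv {m n : nat} (A : Mat m n) (u : Vec m) : Vec n :=
  fun j => vsum (fun i => A i j * u i).
Definition qform {n : nat} (A : Mat n n) (w : Vec n) : R := dot w (mv A w).

Definition frechet {n m : nat} (F : Vec n -> Vec m) (x : Vec n) (J : Mat m n) : Prop :=
  forall eps, 0 < eps -> exists del, 0 < del /\ forall y, vnorm (vsub y x) < del ->
    vnorm (vsub (vsub (F y) (F x)) (mv J (vsub y x))) <= eps * vnorm (vsub y x).
Definition frechet_s {n : nat} (f : Vec n -> R) (x : Vec n) (gr : Vec n) : Prop :=
  forall eps, 0 < eps -> exists del, 0 < del /\ forall y, vnorm (vsub y x) < del ->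
    Rabs (f y - f x - dot gr (vsub y x)) <= eps * vnorm (vsub y x).
Definition mat_cont_at {n a b : nat} (A : Vec n -> Mat a b) (x : Vec n) : Prop :=
  forall i j eps, 0 < eps -> exists del, 0 < del /\ forall y, vnorm (vsub y x) < del ->
    Rabs (A y i j - A x i j) < eps.

Definition seq_conv {n : nat} (u : nat -> Vec n) (x : Vec n) : Prop :=
  forall eps, 0 < eps -> exists N : nat, forall k : nat, (N <= k)%nat -> vnorm (vsub (u k) x) < eps.

Definition is_closed {n : nat} (S : Vec n -> Prop) : Prop :=
  forall (u : nat -> Vec n) x, (forall k, S (u k)) -> seq_conv u x -> S x.
Definition is_open {n : nat} (S : Vec n -> Prop) : Prop :=
  forall x, S x -> exists del, 0 < del /\ forall y, vnorm (vsub y x) < del -> S y.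
Definition is_convex {n : nat} (S : Vec n -> Prop) : Prop :=
  forall x y t, S x -> S y -> 0 <= t <= 1 ->
    S (vadd (vscale t x) (vscale (1 - t) y)).
Definition is_cone {n : nat} (C : Vec n -> Prop) : Prop :=
  forall x t, C x -> 0 <= t -> C (vscale t x).
Definition is_pointed {n : nat} (C : Vec n -> Prop) : Prop :=
  forall x, C x -> C (vopp x) -> x = vzero.

(* distance d(x;S) = inf { |x - s| : s in S } (S nonempty in all uses) *)
Definition dist_set {n : nat} (x : Vec n) (S : Vec n -> Prop) : R :=
  epsilon (inhabits 0) (fun d => (forall s, S s -> d <= vnorm (vsub x s)) /\
     (forall eps, 0 < eps -> exists s, S s /\ vnorm (vsub x s) < d + eps)).

Definition tcone {n : nat} (S : Vec n -> Prop) (u v : Vec n) : Prop :=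
  exists (t : nat -> R) (vk : nat -> Vec n),
    (forall k, 0 < t k) /\ Un_cv t 0 /\ seq_conv vk v /\
    forall k, S (vadd u (vscale (t k) (vk k))).
Definition tcone2 {n : nat} (S : Vec n -> Vec n -> Prop) (u1 u2 v1 v2 : Vec n) : Prop :=
  exists (t : nat -> R) (v1k v2k : nat -> Vec n),
    (forall k, 0 < t k) /\ Un_cv t 0 /\ seq_conv v1k v1 /\ seq_conv v2k v2 /\
    forall k, S (vadd u1 (vscale (t k) (v1k k))) (vadd u2 (vscale (t k) (v2k k))).

(* extended-real-valued functions: None stands for +infinity *)
Definition reg_subdiff {n : nat} (f : Vec n -> option R) (x v : Vec n) : Prop :=
  exists fx, f x = Some fx /\
    forall eps, 0 < eps -> exists del, 0 < del /\ forall y fy,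
      vnorm (vsub y x) < del -> f y = Some fy ->
      fy - fx - dot v (vsub y x) >= - eps * vnorm (vsub y x).
Definition lim_subdiff {n : nat} (f : Vec n -> option R) (x v : Vec n) : Prop :=
  exists fx, f x = Some fx /\
  exists (xk vk : nat -> Vec n) (ak : nat -> R),
    seq_conv xk x /\ seq_conv vk v /\
    (forall k, f (xk k) = Some (ak k)) /\ Un_cv ak fx /\
    (forall k, reg_subdiff f (xk k) (vk k)).
Definition graph_deriv_subdiff {n : nat} (f : Vec n -> option R) (xb vb w z : Vec n) : Prop :=
  tcone2 (lim_subdiff f) xb vb w z.
Definition dom_graph_deriv_subdiff {n : nat} (f : Vec n -> option R) (xb vb w : Vec n) : Prop :=
  exists z, graph_deriv_subdiff f xb vb w z.

Definition Gamma {n m : nat} (q : Vec n -> Vec m) (Theta : Vec m -> Prop) (x : Vec n) : Prop :=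
  Theta (q x).
Definition fobj {n m : nat} (g : Vec n -> R) (q : Vec n -> Vec m) (Theta : Vec m -> Prop)
  (x : Vec n) : option R :=
  if excluded_middle_informative (Gamma q Theta x) then Some (g x) else None.
Definition normal_cone_convex {m : nat} (Theta : Vec m -> Prop) (y lam : Vec m) : Prop :=
  forall y', Theta y' -> dot lam (vsub y' y) <= 0.
Definition Lambda {n m : nat} (Dg : Vec n -> Vec n) (q : Vec n -> Vec m) (Dq : Vec n -> Mat m n)
  (Theta : Vec m -> Prop) (xb : Vec n) (lam : Vec m) : Prop :=
  normal_cone_convex Theta (q xb) lam /\ vadd (Dg xb) (mtv (Dq xb) lam) = vzero.
Definition local_min_P {n m : nat} (g : Vec n -> R) (q : Vec n -> Vec m) (Theta : Vec m -> Prop)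
  (xb : Vec n) : Prop :=
  Gamma q Theta xb /\ exists del, 0 < del /\ forall x, Gamma q Theta x ->
    vnorm (vsub x xb) < del -> g xb <= g x.
Definition crit_cone {n m : nat} (Dg : Vec n -> Vec n) (q : Vec n -> Vec m)
  (Theta : Vec m -> Prop) (xb w : Vec n) : Prop :=
  tcone (Gamma q Theta) xb w /\ dot (Dg xb) w = 0.
(* Hessian in x of the Lagrangian L(x,lam) = g x + <lam, q x> at xb *)
Definition hessL {n m : nat} (D2g : Vec n -> Mat n n) (D2q : Vec n -> 'I_m -> Mat n n)
  (xb : Vec n) (lam : Vec m) : Mat n n :=
  fun a b => D2g xb a b + vsum (fun i => lam i * D2q xb i a b).
(* mu_lam = (Dh(yb)^* )^{-1}(lam): the (unique) mu with Dh(yb)^T mu = lam *)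
Definition mu_of {l m : nat} (Dh : Vec m -> Mat l m) (yb lam : Vec m) : Vec l :=
  epsilon (inhabits (fun _ => 0)) (fun mu : Vec l => mtv (Dh yb) mu = lam).
Definition Htilde_form {n m l : nat} (q : Vec n -> Vec m) (Dq : Vec n -> Mat m n)
  (Dh : Vec m -> Mat l m) (D2h : Vec m -> 'I_l -> Mat m m) (xb : Vec n) (lam : Vec m)
  (w : Vec n) : R :=
  let mu := mu_of Dh (q xb) lam in
  qform (fun a b => vsum (fun k => mu k * D2h (q xb) k a b)) (mv (Dq xb) w).
Definition soc_value {n m l : nat} (D2g : Vec n -> Mat n n) (q : Vec n -> Vec m)
  (Dq : Vec n -> Mat m n) (D2q : Vec n -> 'I_m -> Mat n n)
  (Dh : Vec m -> Mat l m) (D2h : Vec m -> 'I_l -> Mat m m) (xb : Vec n) (lam : Vec m)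
  (w : Vec n) : R :=
  qform (hessL D2g D2q xb lam) w + Htilde_form q Dq Dh D2h xb lam w.

(* Main.v *)
(* Near [xb] the feasible set is [G x \in C] with [G = h \o q], [G xb = 0], and MSCQ passes from [q]
   to [G] because [h] is locally open.  Hence every regular subgradient [v] of [f] at [x] near [xb]
   is [Dg x + DG(x)^T mu] with [mu] normal to [C] at [G x] and [|mu| <= kap |v - Dg x|].  For
   [(w, z)] tangent to the graph of the subdifferential these multipliers accumulate at some
   [mu \in Lambda], and second order expansions of [g] and [G] along the defining sequences show
   that [w] is critical, that [mu] maximises the second order form at [w], and that [<z, w>] equals
   the maximum; if [xb] is a local minimiser this value is nonnegative.  Conversely every critical
   [w] is in the domain of the graphical derivative: minimising [g + (rho/2) |x - xb - t w|^2] over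
   the feasible set and letting [t -> 0] gives a pair [(w', rho (w - w'))], whose second component
   stays bounded as [rho -> oo], since [z - (second order form) w'] is normal to the critical cone
   at [w'].  So (ii), (iii) and (iv) all say that the maximum is nonnegative. *)
Require Import Defs.
From Stdlib Require Import Reals Lra ClassicalEpsilon FunctionalExtensionality Classical.
From HB Require Import structures.
From mathcomp Require Import ssreflect ssrbool ssrfun eqtype ssrnat seq fintype bigop.
From Coquelicot Require Import Coquelicot.
Open Scope R_scope.

(** * Linear algebra and convergence of sequences in Vec n *)

(** Two obstacles shape the proof. Under MSCQ the set [Lambda] may be unbounded, and the image of
    the polar of [C] under the transposed Jacobian need not be closed. Separation is therefore
    applied to the image of the polar truncated to a ball, which is compact; the radius of the ball
    comes from [kap], uniformly at all feasible points near [xb]. The maximum over [Lambda] is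
    obtained neither by compactness nor by conic duality: the accumulation point [mu] is itself a
    maximiser. Along the sequence, complementarity is an equality for the multipliers of the
    sequence and only an inequality for a fixed multiplier. With [eta = z - hessM mu w] this
    compares [mu] with every multiplier up to the term [2 <eta, w>]. The comparison of [mu] with
    itself gives [<eta, w> >= 0], and normality of [eta] gives the other sign. In the penalised
    problems a minimiser could a priori be much farther than [t] from [xb]. A multiplier excludes
    this, because it forces [g] to decrease at most quadratically on the feasible set. *)

HB.instance Definition _ := Monoid.isComLaw.Build R 0 Rplus
  (fun x y z => esym (Rplus_assoc x y z)) Rplus_comm Rplus_0_l.

Lemma vsum_ext {n} (F H : 'I_n -> R) : (forall i, F i = H i) -> vsum F = vsum H.
Proof. by move=> e; apply: eq_bigr => i _. Qed.

Lemma vsumD {n} (F H : 'I_n -> R) : vsum (fun i => F i + H i) = vsum F + vsum H.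
Proof. exact: big_split. Qed.

Lemma vsumZ {n} (a : R) (F : 'I_n -> R) : vsum (fun i => a * F i) = a * vsum F.
Proof.
rewrite /vsum; apply: (big_ind2 (fun x y => x = a * y)) => //; first by ring.
by move=> x1 x2 y1 y2 -> ->; ring.
Qed.

Lemma vsum_exchange {n p} (F : 'I_n -> 'I_p -> R) :
  vsum (fun i => vsum (F i)) = vsum (fun j => vsum (fun i => F i j)).
Proof. exact: exchange_big. Qed.

Lemma vsum_le {n} (F H : 'I_n -> R) : (forall i, F i <= H i) -> vsum F <= vsum H.
Proof.
move=> le; apply: (big_ind2 Rle) => //; first exact: Rle_refl.
by move=> *; apply: Rplus_le_compat.
Qed.

Lemma vsum_ge0 {n} (F : 'I_n -> R) : (forall i, 0 <= F i) -> 0 <= vsum F.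
Proof.
move=> le; apply: (big_ind (Rle 0)) => //; first exact: Rle_refl.
exact: Rplus_le_le_0_compat.
Qed.

Lemma vsum_ge_term {n} (F : 'I_n -> R) i : (forall i, 0 <= F i) -> F i <= vsum F.
Proof.
move=> F0; rewrite /vsum (bigD1 i) //=.
rewrite -[X in X <= _]Rplus_0_r; apply: Rplus_le_compat_l.
apply: (big_ind (Rle 0)) => //; first exact: Rle_refl.
exact: Rplus_le_le_0_compat.
Qed.

Lemma vsum_abs {n} (F : 'I_n -> R) : Rabs (vsum F) <= vsum (fun i => Rabs (F i)).
Proof.
apply: (big_ind2 (fun x y => Rabs x <= y)) => //; first by rewrite Rabs_R0; lra.
- by move=> x1 x2 y1 y2 h1 h2; apply: Rle_trans (Rabs_triang _ _) _; lra.
- by move=> i _; lra.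
Qed.

Lemma vsum_delta {n} (F : 'I_n -> R) i :
  vsum (fun j => F j * (if j == i then 1 else 0)) = F i.
Proof.
rewrite /vsum (bigD1 i) //= eqxx big1 /= ?Rplus_0_r ?Rmult_1_r //.
by move=> j /negbTE ->; ring.
Qed.

Lemma dotC {n} (x y : Vec n) : dot x y = dot y x.
Proof. by apply: vsum_ext => i; ring. Qed.

Lemma dotDl {n} (x y z : Vec n) : dot (vadd x y) z = dot x z + dot y z.
Proof. by rewrite -vsumD; apply: vsum_ext => i; rewrite /vadd; ring. Qed.

Lemma dotZl {n} a (x z : Vec n) : dot (vscale a x) z = a * dot x z.
Proof. by rewrite -vsumZ; apply: vsum_ext => i; rewrite /vscale; ring. Qed.

Lemma dotBl {n} (x y z : Vec n) : dot (vsub x y) z = dot x z - dot y z.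
Proof.
have -> : vsub x y = vadd x (vscale (-1) y).
  by apply: functional_extensionality => i; rewrite /vsub /vadd /vscale; ring.
by rewrite dotDl dotZl; ring.
Qed.

Lemma dotDr {n} (x y z : Vec n) : dot z (vadd x y) = dot z x + dot z y.
Proof. by rewrite dotC dotDl !(dotC z). Qed.

Lemma dotZr {n} a (x z : Vec n) : dot z (vscale a x) = a * dot z x.
Proof. by rewrite dotC dotZl (dotC z). Qed.

Lemma dotBr {n} (x y z : Vec n) : dot z (vsub x y) = dot z x - dot z y.
Proof. by rewrite dotC dotBl !(dotC z). Qed.

Lemma dot0l {n} (z : Vec n) : dot vzero z = 0.
Proof.
have -> : vzero = vscale 0 z by apply: functional_extensionality => i; rewrite /vzero /vscale; ring.
by rewrite dotZl; ring.
Qed.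

Lemma dot0r {n} (z : Vec n) : dot z vzero = 0.
Proof. by rewrite dotC dot0l. Qed.

Lemma dot_ge0 {n} (x : Vec n) : 0 <= dot x x.
Proof. by apply: vsum_ge0 => i; nra. Qed.

Lemma dot_mtv {a b} (A : Mat a b) u v : dot (mtv A u) v = dot u (mv A v).
Proof.
rewrite /dot /mtv /mv.
transitivity (vsum (fun j => vsum (fun i => A i j * u i * v j))).
  by apply: vsum_ext => j; rewrite Rmult_comm -vsumZ; apply: vsum_ext => i; ring.
rewrite -vsum_exchange; apply: vsum_ext => i.
by rewrite -vsumZ; apply: vsum_ext => j; ring.
Qed.

Lemma mvD {a b} (A : Mat a b) u v : mv A (vadd u v) = vadd (mv A u) (mv A v).
Proof.
apply: functional_extensionality => i; rewrite /mv /vadd -vsumD.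
by apply: vsum_ext => j; ring.
Qed.

Lemma mvZ {a b} (A : Mat a b) c v : mv A (vscale c v) = vscale c (mv A v).
Proof.
apply: functional_extensionality => i; rewrite /mv /vscale -vsumZ.
by apply: vsum_ext => j; ring.
Qed.

Lemma mvB {a b} (A : Mat a b) u v : mv A (vsub u v) = vsub (mv A u) (mv A v).
Proof.
have -> : vsub u v = vadd u (vscale (-1) v).
  by apply: functional_extensionality => i; rewrite /vsub /vadd /vscale; ring.
by rewrite mvD mvZ; apply: functional_extensionality => i; rewrite /vsub /vadd /vscale; ring.
Qed.

Lemma mtvD {a b} (A : Mat a b) u v : mtv A (vadd u v) = vadd (mtv A u) (mtv A v).
Proof. exact: (mvD (fun j i => A i j)). Qed.

Lemma mtvZ {a b} (A : Mat a b) c v : mtv A (vscale c v) = vscale c (mtv A v).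
Proof. exact: (mvZ (fun j i => A i j)). Qed.

Lemma dot_ext {n} (x y : Vec n) : (forall u, dot x u = dot y u) -> x = y.
Proof.
move=> e; apply: functional_extensionality => i.
by have := e (fun j => if j == i then 1 else 0); rewrite /dot !vsum_delta.
Qed.

Lemma vnorm_ge0 {n} (x : Vec n) : 0 <= vnorm x.
Proof. exact: sqrt_pos. Qed.

Lemma vnorm_sq {n} (x : Vec n) : vnorm x * vnorm x = dot x x.
Proof. exact: sqrt_sqrt (dot_ge0 x). Qed.

Lemma vnormZ {n} a (x : Vec n) : vnorm (vscale a x) = Rabs a * vnorm x.
Proof.
rewrite /vnorm dotZl dotZr -Rmult_assoc sqrt_mult_alt; last by nra.
by rewrite -/(Rsqr a) sqrt_Rsqr_abs.
Qed.

Lemma vnorm_coord {n} (x : Vec n) i : Rabs (x i) <= vnorm x.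
Proof.
rewrite -sqrt_Rsqr_abs; apply: sqrt_le_1_alt.
by apply: (vsum_ge_term (fun i => x i * x i)) => j; nra.
Qed.

Lemma vnorm0_eq {n} (x : Vec n) : vnorm x = 0 -> x = vzero.
Proof.
move=> e; apply: functional_extensionality => i.
have := vnorm_coord x i; rewrite e /vzero; split_Rabs; lra.
Qed.

Lemma vnorm_zero {n} : vnorm (@vzero n) = 0.
Proof. by rewrite /vnorm dot0l sqrt_0. Qed.

(** Cauchy-Schwarz, by expanding the square of [|y| x - |x| y] and dividing by [2 |x| |y|]; this
    division is why zero norms are treated apart. *)
Lemma dot_le_norm {n} (x y : Vec n) : dot x y <= vnorm x * vnorm y.
Proof.
have [ex|nx] := Req_dec (vnorm x) 0.
  by rewrite (vnorm0_eq x ex) dot0l vnorm_zero; lra.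
have [ey|ny] := Req_dec (vnorm y) 0.
  by rewrite (vnorm0_eq y ey) dot0r vnorm_zero; lra.
have px := vnorm_ge0 x; have py := vnorm_ge0 y.
have := dot_ge0 (vsub (vscale (vnorm y) x) (vscale (vnorm x) y)).
rewrite dotBl !dotBr !dotZl !dotZr (dotC y x) -!vnorm_sq => H.
apply: (Rmult_le_reg_l (2 * (vnorm x * vnorm y))); last by nra.
by apply: Rmult_lt_0_compat; first lra; apply: Rmult_lt_0_compat; lra.
Qed.

Lemma vnormD {n} (x y : Vec n) : vnorm (vadd x y) <= vnorm x + vnorm y.
Proof.
have := vnorm_sq (vadd x y); rewrite dotDl !dotDr (dotC y x) -!vnorm_sq => e.
have := dot_le_norm x y; have := vnorm_ge0 x; have := vnorm_ge0 y.
have := vnorm_ge0 (vadd x y); nra.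
Qed.

Lemma vnorm_subC {n} (x y : Vec n) : vnorm (vsub x y) = vnorm (vsub y x).
Proof.
have -> : vsub x y = vscale (-1) (vsub y x).
  by apply: functional_extensionality => i; rewrite /vsub /vscale; ring.
by rewrite vnormZ Rabs_Ropp Rabs_R1; ring.
Qed.

Lemma vnorm_tri {n} (y x z : Vec n) : vnorm (vsub x z) <= vnorm (vsub x y) + vnorm (vsub y z).
Proof.
have -> : vsub x z = vadd (vsub x y) (vsub y z).
  by apply: functional_extensionality => i; rewrite /vsub /vadd; ring.
exact: vnormD.
Qed.

Lemma vsubvv {n} (x : Vec n) : vsub x x = vzero.
Proof. by apply: functional_extensionality => i; rewrite /vsub /vzero; ring. Qed.

Lemma vsub_addl {n} (x y : Vec n) : vsub (vadd x y) x = y.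
Proof. by apply: functional_extensionality => i; rewrite /vsub /vadd; ring. Qed.

Lemma vadd_subK {n} (x y : Vec n) : vadd x (vsub y x) = y.
Proof. by apply: functional_extensionality => i; rewrite /vsub /vadd; ring. Qed.

(** The sum of the absolute entries is a crude operator bound, but it is continuous and monotone in
    the entries, which is how [right_inverse_near] and [hessM_bound] use it. *)
Lemma mv_bound {a b} (A : Mat a b) v :
  vnorm (mv A v) <= vsum (fun i => vsum (fun j => Rabs (A i j))) * vnorm v.
Proof.
set S := vsum _.
have S0 : 0 <= S by do 2![apply: vsum_ge0 => ?]; apply: Rabs_pos.
have row i : Rabs (mv A v i) <= vsum (fun j => Rabs (A i j)) * vnorm v.
  apply: Rle_trans (vsum_abs _) _; rewrite Rmult_comm -vsumZ.
  apply: vsum_le => j; rewrite Rabs_mult Rmult_comm.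
  by apply: Rmult_le_compat_r; [apply: Rabs_pos | apply: vnorm_coord].
have rS i : Rabs (mv A v i) <= S * vnorm v.
  apply: Rle_trans (row i) _; apply: Rmult_le_compat_r; first exact: vnorm_ge0.
  apply: (vsum_ge_term (fun i => vsum (fun j => Rabs (A i j)))) => j.
  by apply: vsum_ge0 => ?; apply: Rabs_pos.
have n0 := vnorm_ge0 v.
apply: Rsqr_incr_0_var; last nra.
rewrite /Rsqr vnorm_sq.
apply: (Rle_trans _ (vsum (fun i => (S * vnorm v) * (vsum (fun j => Rabs (A i j)) * vnorm v)))).
  apply: vsum_le => i; have := rS i; have := row i; have := Rabs_pos (mv A v i).
  move=> h0 h1 h2; apply: (Rle_trans _ (Rabs (mv A v i) * Rabs (mv A v i))).
    by rewrite -Rabs_mult; apply: Rle_abs.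
  by apply: Rmult_le_compat.
rewrite vsumZ; apply: Rmult_le_compat_l; first nra.
rewrite [X in X <= _](_ : _ = S * vnorm v); first lra.
by rewrite Rmult_comm -vsumZ; apply: vsum_ext => i; ring.
Qed.

(** Vector limits are taken coordinate by coordinate, so that they reduce to the limit rules for
    real sequences; [seq_convP] identifies them with norm convergence. *)
Definition cv (u : nat -> R) (x : R) := is_lim_seq u (Finite x).
Definition vcv {n} (u : nat -> Vec n) (x : Vec n) := forall i, cv (fun k => u k i) (x i).

Lemma cvP u x : cv u x <->
  (forall eps, 0 < eps -> exists N : nat, forall k : nat, (N <= k)%nat -> Rabs (u k - x) < eps).
Proof.
rewrite /cv is_lim_seq_Reals; split=> H eps e0; have [N HN] := H eps e0; exists N => k Hk.
  by apply: HN; apply/leP.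
by apply: HN; apply/leP.
Qed.

Lemma cv_unique u x y : cv u x -> cv u y -> x = y.
Proof. by move=> /is_lim_seq_unique h /is_lim_seq_unique; rewrite h; case. Qed.

Lemma cv_ext u v x y : cv u x -> (forall k, u k = v k) -> x = y -> cv v y.
Proof. by move=> h e <-; apply: is_lim_seq_ext h. Qed.

Lemma cv_cst a : cv (fun _ => a) a.
Proof. exact: is_lim_seq_const. Qed.

Lemma cvD u v x y : cv u x -> cv v y -> cv (fun k => u k + v k) (x + y).
Proof. exact: is_lim_seq_plus'. Qed.

Lemma cvB u v x y : cv u x -> cv v y -> cv (fun k => u k - v k) (x - y).
Proof. exact: is_lim_seq_minus'. Qed.

Lemma cvM u v x y : cv u x -> cv v y -> cv (fun k => u k * v k) (x * y).
Proof. exact: is_lim_seq_mult'. Qed.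

Lemma cv_le u v x y : (forall k, u k <= v k) -> cv u x -> cv v y -> x <= y.
Proof. exact: (is_lim_seq_le u v). Qed.

Lemma cv_subseq (phi : nat -> nat) u x : (forall k, (phi k < phi k.+1)%nat) -> cv u x ->
  cv (fun k => u (phi k)) x.
Proof.
move=> h hu; apply: (is_lim_seq_subseq u _ phi) hu.
by apply: eventually_subseq => k; exact/ltP.
Qed.

Lemma cv_sum {n} (F : nat -> 'I_n -> R) (L : 'I_n -> R) :
  (forall i, cv (fun k => F k i) (L i)) -> cv (fun k => vsum (F k)) (vsum L).
Proof.
move=> H; rewrite /vsum.
elim: (index_enum _) => [|i s IH].
  by apply: (cv_ext _ _ _ _ (cv_cst 0)) => [k|]; rewrite big_nil.
have h := cvD _ _ _ _ (H i) IH.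
by apply: cv_ext h _ _ => [k|]; rewrite big_cons.
Qed.

Lemma cv_dot {n} (u v : nat -> Vec n) x y : vcv u x -> vcv v y ->
  cv (fun k => dot (u k) (v k)) (dot x y).
Proof. by move=> hu hv; apply: cv_sum => i; apply: cvM. Qed.

Lemma vcv_cst {n} (x : Vec n) : vcv (fun _ => x) x.
Proof. by move=> i; apply: cv_cst. Qed.

Lemma vcvD {n} (u v : nat -> Vec n) x y : vcv u x -> vcv v y ->
  vcv (fun k => vadd (u k) (v k)) (vadd x y).
Proof. by move=> hu hv i; apply: cvD. Qed.

Lemma vcvB {n} (u v : nat -> Vec n) x y : vcv u x -> vcv v y ->
  vcv (fun k => vsub (u k) (v k)) (vsub x y).
Proof. by move=> hu hv i; apply: cvB. Qed.

Lemma vcvZ {n} (a : nat -> R) (v : nat -> Vec n) b y : cv a b -> vcv v y ->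
  vcv (fun k => vscale (a k) (v k)) (vscale b y).
Proof. by move=> hu hv i; apply: cvM. Qed.

Lemma vcv_mv {a b} (A : Mat a b) u x : vcv u x -> vcv (fun k => mv A (u k)) (mv A x).
Proof. by move=> h i; apply: cv_sum => j; apply: cvM => //; apply: cv_cst. Qed.

Lemma vcv_mtv {a b} (A : Mat a b) u x : vcv u x -> vcv (fun k => mtv A (u k)) (mtv A x).
Proof. exact: (vcv_mv (fun j i => A i j)). Qed.

Lemma cv_norm {n} (u : nat -> Vec n) x : vcv u x -> cv (fun k => vnorm (u k)) (vnorm x).
Proof.
move=> h; apply: (is_lim_seq_continuous sqrt (fun k => dot (u k) (u k))).
  by apply: continuity_pt_sqrt; apply: dot_ge0.
exact: cv_dot.
Qed.

Lemma vcv_ext {n} (u v : nat -> Vec n) x y : vcv u x -> (forall k, u k = v k) -> x = y -> vcv v y.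
Proof. by move=> h e <- i; apply: cv_ext (h i) _ _ => // k; rewrite e. Qed.

Lemma vcv_subseq {n} (phi : nat -> nat) (u : nat -> Vec n) x :
  (forall k, (phi k < phi k.+1)%nat) -> vcv u x -> vcv (fun k => u (phi k)) x.
Proof. by move=> h hu i; apply: (cv_subseq phi (fun k => u k i)). Qed.

Lemma seq_convP {n} (u : nat -> Vec n) x : seq_conv u x <-> vcv u x.
Proof.
split=> H.
  move=> i; apply/cvP => eps e0; have [N HN] := H eps e0; exists N => k hk.
  exact: Rle_lt_trans (vnorm_coord (vsub (u k) x) i) (HN k hk).
have := cv_norm _ _ (vcvB _ _ _ _ H (vcv_cst x)).
rewrite vsubvv vnorm_zero => /cvP h eps e0; have [N HN] := h eps e0; exists N => k hk.
by have := HN k hk; rewrite Rminus_0_r Rabs_pos_eq //; apply: vnorm_ge0.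
Qed.

Lemma vcv_of_le {n} (u : nat -> Vec n) x (a : nat -> R) :
  (forall k, vnorm (vsub (u k) x) <= a k) -> cv a 0 -> vcv u x.
Proof.
move=> h /cvP ha; apply/seq_convP => eps e0; have [N HN] := ha eps e0; exists N => k hk.
have := HN k hk; have := h k; split_Rabs; lra.
Qed.

Lemma cv0_of_le (u a : nat -> R) : (forall k, Rabs (u k) <= a k) -> cv a 0 -> cv u 0.
Proof.
move=> h /cvP ha; apply/cvP => eps e0; have [N HN] := ha eps e0; exists N => k hk.
have := HN k hk; have := h k; split_Rabs; lra.
Qed.

Lemma inv_succ_gt0 k : 0 < / (INR k + 1).
Proof. by apply: Rinv_0_lt_compat; have := pos_INR k; lra. Qed.

Lemma cv_inv_succ : cv (fun k => / (INR k + 1)) 0.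
Proof.
apply: (is_lim_seq_inv _ p_infty) => //.
apply: (is_lim_seq_plus _ _ p_infty 1) => //; first exact: is_lim_seq_INR.
exact: is_lim_seq_const.
Qed.

Lemma cv_eventually_lt u x a : cv u x -> x < a ->
  exists N : nat, forall k : nat, (N <= k)%nat -> u k < a.
Proof.
move=> /cvP h xa; have [|N HN] := h (a - x); first lra.
by exists N => k /HN; split_Rabs; lra.
Qed.

Lemma cv_shift u x N : cv u x -> cv (fun k => u (k + N)%nat) x.
Proof. by move=> h; apply: (cv_subseq (fun k => (k + N)%nat)) => // k; rewrite addSn ltnS. Qed.

Lemma vcv_shift {n} (u : nat -> Vec n) x N : vcv u x -> vcv (fun k => u (k + N)%nat) x.
Proof. by move=> h i; apply: cv_shift (h i). Qed.

(** [Bolzano_Weierstrass] yields a cluster point; the indices are then chosen recursively, each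
    beyond the previous one and with error below [/ (INR k + 1)]. *)
Lemma bounded_subseq_R (u : nat -> R) B : (forall k, Rabs (u k) <= B) ->
  exists phi : nat -> nat, (forall k, (phi k < phi k.+1)%nat) /\ exists x, cv (fun k => u (phi k)) x.
Proof.
move=> hB.
have [|x Hx] := Bolzano_Weierstrass u (fun c => - B <= c <= B) (compact_P3 (- B) B).
  by move=> k; have := hB k; split_Rabs; lra.
have pick N k : {p : nat | (N < p)%nat /\ Rabs (u p - x) < / (INR k + 1)}.
  apply: constructive_indefinite_description.
  have [|p [hp hx]] := Hx (disc x (mkposreal _ (inv_succ_gt0 k))) N.+1.
    by exists (mkposreal _ (inv_succ_gt0 k)) => y.
  by exists p; split=> //; apply/ltP.
pose phi := fix phi k := match k with O => sval (pick O O)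
                                    | S j => sval (pick (phi j) (S j)) end.
have phi_lt k : (phi k < phi k.+1)%nat by exact: (proj1 (svalP (pick (phi k) k.+1))).
exists phi; split=> //; exists x.
have h k : Rabs (u (phi k) - x) <= / (INR k + 1).
  by case: k => [|k]; apply: Rlt_le;
    [exact: (proj2 (svalP (pick _ _))) | exact: (proj2 (svalP (pick (phi k) k.+1)))].
have := cvD _ _ _ _ (cv0_of_le _ _ h cv_inv_succ) (cv_cst x).
by move=> H; apply: cv_ext H _ _ => [k|]; ring.
Qed.

Lemma bounded_subseq {n} (u : nat -> Vec n) B : (forall k, vnorm (u k) <= B) ->
  exists phi : nat -> nat, (forall k, (phi k < phi k.+1)%nat) /\
    exists x, vcv (fun k => u (phi k)) x.
Proof.
move=> hB.
(* The first [j] coordinates are made to converge; a further extraction for the next coordinate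
   preserves the limits already obtained. *)
suff : forall j, (j <= n)%nat -> exists phi : nat -> nat, (forall k, (phi k < phi k.+1)%nat) /\
   exists x : Vec n, forall i : 'I_n, (i < j)%nat -> cv (fun k => u (phi k) i) (x i).
  move=> /(_ n (leqnn n)) [phi [h [x hx]]]; exists phi; split=> //; exists x => i.
  exact: hx.
elim=> [_|j IH hj].
  by exists id; split=> //; exists vzero.
have [phi [h [x hx]]] := IH (ltnW hj).
have [psi [h' [y hy]]] := bounded_subseq_R (fun k => u (phi k) (Ordinal hj)) B
   (fun k => Rle_trans _ _ _ (vnorm_coord _ _) (hB (phi k))).
exists (fun k => phi (psi k)); split.
  move=> k; have := h' k.
  have mono a b : (a < b)%nat -> (phi a < phi b)%nat.
    elim: b => // b IHb; rewrite ltnS leq_eqVlt => /orP [/eqP ->|/IHb hb]; first exact: h.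
    exact: ltn_trans hb (h b).
  exact: mono.
exists (fun i => if i == Ordinal hj then y else x i) => i.
case: eqP => [->//|ne]; rewrite ltnS leq_eqVlt => /orP [/eqP e|lt].
  by case: ne; apply: val_inj.
exact: (cv_subseq psi (fun k => u (phi k) i)) (hx i lt).
Qed.

(** * Minimisation, projections, tangent cones and Hadamard derivatives *)

Ltac vring := apply: functional_extensionality => ?; rewrite /vsub /vadd /vscale /vzero; ring.
Ltac vfield := apply: functional_extensionality => ?; rewrite /vsub /vadd /vscale /vzero; field.

Lemma choose_seq {T} (P : nat -> T -> Prop) : (forall k, exists x, P k x) ->
  exists u, forall k, P k (u k).
Proof.
move=> h; exists (fun k => sval (constructive_indefinite_description _ (h k))) => k.
by case: constructive_indefinite_description.
Qed.

(* Minimising [atan \o phi] instead of [phi] makes the infimum finite for free. *)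
Lemma exists_min {n} (S : Vec n -> Prop) (phi : Vec n -> R) B :
  (exists x, S x) -> (forall x, S x -> vnorm x <= B) -> is_closed S ->
  (forall u x, (forall k, S (u k)) -> S x -> vcv u x -> cv (fun k => phi (u k)) (phi x)) ->
  exists x, S x /\ forall y, S y -> phi x <= phi y.
Proof.
move=> [x0 Sx0] bS cS phic.
pose E r := exists x, S x /\ r = - atan (phi x).
have [||s [ubs lubs]] := completeness E.
- exists PI => r [x [_ ->]]; have := atan_bound (phi x); lra.
- by exists (- atan (phi x0)), x0.
have [u hu] : exists u, forall k, S (u k) /\ s - / (INR k + 1) <= - atan (phi (u k)).
  apply: (choose_seq (fun k x => S x /\ s - / (INR k + 1) <= - atan (phi x))) => k; apply: NNPP => hn.
  have e0 := inv_succ_gt0 k.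
  suff : s <= s - / (INR k + 1) by lra.
  apply: lubs => r [x [Sx ->]]; apply: Rnot_lt_le => lt; apply: hn; exists x; split=> //; lra.
have [th [hth [x hx]]] := bounded_subseq u B (fun k => bS _ (proj1 (hu k))).
have Sx : S x by apply: (cS (fun k => u (th k))) => [k|]; [case: (hu (th k)) | apply/seq_convP].
exists x; split=> // y Sy; apply: Rnot_lt_le => /atan_increasing lt.
have hs : s <= - atan (phi x).
  have h1 := cv_subseq th _ _ hth cv_inv_succ.
  have h2 : cv (fun k => atan (phi (u (th k)))) (atan (phi x)).
    apply: (is_lim_seq_continuous atan (fun k => phi (u (th k)))).
      exact: derivable_continuous_pt (derivable_pt_atan _).
    by apply: phic => // k; case: (hu (th k)).
  have := cv_le _ _ _ _ (fun k => proj2 (hu (th k))) (cvB _ _ _ _ (cv_cst s) h1)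
    (cv_ext _ (fun k => - atan (phi (u (th k)))) _ (- atan (phi x)) (cvB _ _ _ _ (cv_cst 0) h2) _ _).
  by move=> H; have := H (fun k => ltac:(ring)) ltac:(ring); lra.
have := ubs (- atan (phi y)); have : E (- atan (phi y)) by exists y.
by move=> e /(_ e); lra.
Qed.

Lemma exists_proj {n} (S : Vec n -> Prop) x : (exists y, S y) -> is_closed S -> is_convex S ->
  exists p, S p /\ forall y, S y -> dot (vsub x p) (vsub y p) <= 0.
Proof.
move=> [s0 Ss0] cS vS.
pose S' y := S y /\ vnorm (vsub x y) <= vnorm (vsub x s0).
have [||||p [[Sp np] hp]] := exists_min S' (fun y => vnorm (vsub x y)) (vnorm x + vnorm (vsub x s0)).
- by exists s0; split=> //; lra.
- move=> y [_ hy]; have -> : y = vsub x (vsub x y) by vring.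
  have := vnorm_tri vzero x (vsub x y); rewrite (vnorm_subC vzero).
  have e v : vsub v vzero = v :> Vec n by vring.
  by rewrite !e; lra.
- move=> u y hu /[dup] /seq_convP uy cy; split; first by apply: cS cy => k; case: (hu k).
  apply: cv_le (fun k => proj2 (hu k)) _ (cv_cst _).
  by apply: cv_norm; apply: vcvB => //; apply: vcv_cst.
- by move=> u y _ _ uy; apply: cv_norm; apply: vcvB => //; apply: vcv_cst.
exists p; split=> // y Sy.
pose a := dot (vsub x p) (vsub y p); pose b := dot (vsub y p) (vsub y p).
have b0 : 0 <= b := dot_ge0 _.
apply: Rnot_lt_le; rewrite -/a => a0.
(* Moving from [p] towards [y] by [t] changes the squared distance to [x] by [t * (t * b - 2 * a)].
   This choice gives [t <= 1] and [t * b < a], hence a strict decrease. *)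
pose t := a / (a + b + 1).
have d0 : 0 < a + b + 1 by lra.
have ht : t * (a + b + 1) = a by rewrite /t; field; lra.
have t0 : 0 < t by rewrite /t; apply: Rdiv_lt_0_compat.
have t1 : t <= 1 by nra.
pose y' := vadd (vscale t y) (vscale (1 - t) p).
have Sy' : S y' by apply: vS => //; lra.
have : vnorm (vsub x p) <= vnorm (vsub x y').
  have [le|lt] := Rle_lt_dec (vnorm (vsub x y')) (vnorm (vsub x s0)); first exact: hp.
  lra.
move=> le; have := Rmult_le_compat _ _ _ _ (vnorm_ge0 _) (vnorm_ge0 _) le le.
rewrite !vnorm_sq.
have -> : vsub x y' = vsub (vsub x p) (vscale t (vsub y p)) by rewrite /y'; vring.
rewrite /a /b in a0 b0 t0 t1 ht *.
move: (vsub x p) (vsub y p) (t) t0 t1 ht a0 b0 => X Y c c0 c1 hc a0 b0.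
rewrite dotBl !dotBr !dotZl !dotZr (dotC Y X).
nra.
Qed.

(** [dist_set] is a choice operator, so its specification is available only once the infimum is
    shown to exist, here as the opposite of a supremum of negated distances. *)
Lemma dist_setP {n} (S : Vec n -> Prop) x : (exists s, S s) ->
  (forall s, S s -> dist_set x S <= vnorm (vsub x s)) /\
  (forall eps, 0 < eps -> exists s, S s /\ vnorm (vsub x s) < dist_set x S + eps).
Proof.
move=> [s0 Ss0].
apply: (epsilon_spec (inhabits 0) (fun d => (forall s, S s -> d <= vnorm (vsub x s)) /\
     (forall eps, 0 < eps -> exists s, S s /\ vnorm (vsub x s) < d + eps))).
have [||d [ub lub]] := completeness (fun r => exists s, S s /\ r = - vnorm (vsub x s)).
- exists 0 => r [s [_ ->]]; have := vnorm_ge0 (vsub x s); lra.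
- by exists (- vnorm (vsub x s0)), s0.
exists (- d); split=> [s Ss|eps e0].
  by have := ub (- vnorm (vsub x s)) (ex_intro _ s (conj Ss erefl)); lra.
apply: NNPP => hn; suff : d <= d - eps by lra.
apply: lub => r [s [Ss ->]]; apply: Rnot_lt_le => lt; apply: hn; exists s; split=> //; lra.
Qed.

(** With one scale per [eps] instead of sequences, the diagonal arguments of the next lemmas become
    triangle inequalities. *)
Lemma tcone2P {n} (S : Vec n -> Vec n -> Prop) u1 u2 v1 v2 :
  tcone2 S u1 u2 v1 v2 <-> forall eps, 0 < eps -> exists t w1 w2,
    [/\ 0 < t < eps, vnorm (vsub w1 v1) < eps, vnorm (vsub w2 v2) < eps &
        S (vadd u1 (vscale t w1)) (vadd u2 (vscale t w2))].
Proof.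
split.
  move=> [t [w1 [w2 [t0 [/is_lim_seq_Reals ct [c1 [c2 hS]]]]]]] eps e0.
  have [N1 H1] := c1 _ e0; have [N2 H2] := c2 _ e0; have [N3 H3] := cv_eventually_lt _ _ eps ct e0.
  pose N := maxn N1 (maxn N2 N3).
  exists (t N), (w1 N), (w2 N); split=> //.
  - by split=> //; apply: H3; rewrite /N !leq_max leqnn !orbT.
  - by apply: H1; rewrite /N !leq_max leqnn.
  - by apply: H2; rewrite /N !leq_max leqnn !orbT.
move=> h.
have [p hp] := choose_seq (fun k (p : R * (Vec n * Vec n)) =>
    [/\ 0 < p.1 < / (INR k + 1), vnorm (vsub p.2.1 v1) < / (INR k + 1),
     vnorm (vsub p.2.2 v2) < / (INR k + 1) &
        S (vadd u1 (vscale p.1 p.2.1)) (vadd u2 (vscale p.1 p.2.2))])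
  (fun k => let: ex_intro t (ex_intro w1 (ex_intro w2 hh)) := h _ (inv_succ_gt0 k) in
      ex_intro _ (t, (w1, w2)) hh).
exists (fun k => (p k).1), (fun k => (p k).2.1), (fun k => (p k).2.2).
split; first by move=> k; case: (hp k) => [[]].
split.
  apply/is_lim_seq_Reals; apply: cv0_of_le cv_inv_succ => k.
  by case: (hp k) => ? _ _ _; rewrite Rabs_pos_eq; lra.
split.
  by apply/seq_convP; apply: vcv_of_le cv_inv_succ => k; case: (hp k) => _ /Rlt_le.
split.
  by apply/seq_convP; apply: vcv_of_le cv_inv_succ => k; case: (hp k) => _ _ /Rlt_le.
by move=> k; case: (hp k).
Qed.

Lemma tcone2_closed {n} (S : Vec n -> Vec n -> Prop) u1 u2 v1 v2 (w1 w2 : nat -> Vec n) :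
  (forall k, tcone2 S u1 u2 (w1 k) (w2 k)) -> vcv w1 v1 -> vcv w2 v2 -> tcone2 S u1 u2 v1 v2.
Proof.
move=> h /seq_convP c1 /seq_convP c2; apply/tcone2P => eps e0.
have e2 : 0 < eps / 2 by lra.
have [N1 H1] := c1 _ e2; have [N2 H2] := c2 _ e2.
have [t [a [b [ht ha hb hS]]]] := proj1 (tcone2P _ _ _ _ _) (h (maxn N1 N2)) _ e2.
exists t, a, b; split=> //; first lra.
- have := vnorm_tri (w1 (maxn N1 N2)) a v1; have := H1 _ (leq_maxl N1 N2); lra.
- have := vnorm_tri (w2 (maxn N1 N2)) b v2; have := H2 _ (leq_maxr N1 N2); lra.
Qed.

Lemma lim_subdiff_of_reg {n} (f : Vec n -> option R) x v :
  reg_subdiff f x v -> lim_subdiff f x v.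
Proof.
move=> [fx [e h]]; exists fx; split=> //.
exists (fun _ => x), (fun _ => v), (fun _ => fx); split; first by apply/seq_convP; apply: vcv_cst.
split; first by apply/seq_convP; apply: vcv_cst.
by split=> //; split; [apply/is_lim_seq_Reals; apply: cv_cst | move=> _; exists fx].
Qed.

(** At scale [t], a limiting subgradient pair is replaced by a regular one within [t * (eps / 2)];
    division by [t] leaves an error [eps / 2] in the directions. *)
Lemma tcone2_lim_subdiff {n} (f : Vec n -> option R) x v w z :
  tcone2 (lim_subdiff f) x v w z -> tcone2 (reg_subdiff f) x v w z.
Proof.
move=> /tcone2P h; apply/tcone2P => eps e0.
have e2 : 0 < eps / 2 by lra.
have [t [a [b [ht ha hb [fx [_ [xk [vk [ak [cx [cw [_ [_ hr]]]]]]]]]]]]] := h _ e2.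
have e3 : 0 < t * (eps / 2) by nra.
have [N1 H1] := cx _ e3; have [N2 H2] := cw _ e3.
set N := maxn N1 N2; have := H1 N (leq_maxl _ _); have := H2 N (leq_maxr _ _).
have aux (u p c : Vec n) : vnorm (vsub p (vadd u (vscale t c))) < t * (eps / 2) ->
    vnorm (vsub (vscale (/ t) (vsub p u)) c) < eps / 2.
  move=> H; have -> : vsub (vscale (/ t) (vsub p u)) c
      = vscale (/ t) (vsub p (vadd u (vscale t c))) by vfield; lra.
  rewrite vnormZ Rabs_pos_eq; last by apply/Rlt_le/Rinv_0_lt_compat; lra.
  apply: (Rmult_lt_reg_l t); first lra.
  by rewrite -Rmult_assoc Rinv_r ?Rmult_1_l //; lra.
move=> /aux Hv /aux Hx.
exists t, (vscale (/ t) (vsub (xk N) x)), (vscale (/ t) (vsub (vk N) v)); split; first lra.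
- have := vnorm_tri a (vscale (/ t) (vsub (xk N) x)) w; lra.
- have := vnorm_tri b (vscale (/ t) (vsub (vk N) v)) z; lra.
have e (u p : Vec n) : vadd u (vscale t (vscale (/ t) (vsub p u))) = p by vfield; lra.
by rewrite !e.
Qed.

(* Hadamard derivative: in sequential form the chain rule needs no remainder estimate. *)
Definition hder {n} (phi : Vec n -> R) (x gr : Vec n) : Prop :=
  forall (t : nat -> R) (w : nat -> Vec n) w0,
    (forall k, t k <> 0) -> cv t 0 -> vcv w w0 ->
    cv (fun k => (phi (vadd x (vscale (t k) (w k))) - phi x) / t k) (dot gr w0).

Lemma vcv_vadd_vscale {n} (x : Vec n) t w w0 : cv t 0 -> vcv w w0 ->
  vcv (fun k => vadd x (vscale (t k) (w k))) x.
Proof.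
move=> ht hw; apply: vcv_ext (vcvD _ _ _ _ (vcv_cst x) (vcvZ _ _ _ _ ht hw)) _ _ => // .
by vring.
Qed.

Lemma frechet_s_hder {n} (phi : Vec n -> R) x gr : frechet_s phi x gr -> hder phi x gr.
Proof.
move=> h t w w0 tn ct cw.
set Q := fun k => _.
suff H : cv (fun k => Q k - dot gr (w k)) 0.
  have := cvD _ _ _ _ H (cv_dot _ _ _ _ (vcv_cst gr) cw).
  by move=> H'; apply: cv_ext H' _ _ => [k|]; ring.
apply/cvP => eps e0.
pose e := eps / (vnorm w0 + 2).
have w00 := vnorm_ge0 w0.
have e'0 : 0 < e by apply: Rdiv_lt_0_compat; lra.
have [del [d0 hd]] := h _ e'0.
have [N1 H1] := cv_eventually_lt _ _ (vnorm w0 + 1) (cv_norm _ _ cw) ltac:(lra).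
have /seq_convP cx := vcv_vadd_vscale x t w w0 ct cw.
have [N2 H2] := cx _ d0.
exists (maxn N1 N2) => k; rewrite geq_max => /andP [/H1 k1 /H2 k2].
have := hd _ k2; rewrite vsub_addl dotZr vnormZ.
have -> : phi (vadd x (vscale (t k) (w k))) - phi x - t k * dot gr (w k)
   = t k * (Q k - dot gr (w k)) by rewrite /Q; field.
rewrite Rabs_mult Rminus_0_r => H.
have tp : 0 < Rabs (t k) by apply: Rabs_pos_lt.
have nw := vnorm_ge0 (w k).
have : Rabs (Q k - dot gr (w k)) <= e * vnorm (w k).
  by apply: (Rmult_le_reg_l (Rabs (t k))) => //; lra.
have : e * (vnorm w0 + 2) = eps by rewrite /e; field; lra.
by nra.
Qed.

Lemma frechet_row {n m} (F : Vec n -> Vec m) x J i : frechet F x J ->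
  frechet_s (fun y => F y i) x (J i).
Proof.
move=> h eps e0; have [d [d0 hd]] := h eps e0; exists d; split=> // y hy.
exact: Rle_trans (vnorm_coord _ i) (hd y hy).
Qed.

Lemma frechet_hder {n m} (F : Vec n -> Vec m) x J i : frechet F x J ->
  hder (fun y => F y i) x (J i).
Proof. by move=> h; apply/frechet_s_hder/frechet_row. Qed.

Lemma frechet_s_cont {n} (phi : Vec n -> R) x gr u : frechet_s phi x gr -> vcv u x ->
  cv (fun k => phi (u k)) (phi x).
Proof.
move=> h cu; have [d [d0 hd]] := h 1 Rlt_0_1.
have /seq_convP cu' := cu; have [N HN] := cu' _ d0.
have c0 : cv (fun k => vnorm (vsub (u k) x)) 0.
  have := cv_norm _ _ (vcvB _ _ _ _ cu (vcv_cst x)).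
  by rewrite vsubvv vnorm_zero.
have c1 : cv (fun k => (1 + vnorm gr) * vnorm (vsub (u k) x)) 0.
  by apply: cv_ext (cvM _ _ _ _ (cv_cst (1 + vnorm gr)) c0) _ _ => // ; ring.
move/cvP: c1 => c1; apply/cvP => eps e0; have [N' HN'] := c1 eps e0.
exists (maxn N N') => k; rewrite geq_max => /andP [/HN k1 /HN'].
have := hd _ k1; have := dot_le_norm gr (vsub (u k) x).
have := dot_le_norm gr (vscale (-1) (vsub (u k) x)); rewrite dotZr vnormZ Rabs_Ropp Rabs_R1.
split_Rabs; lra.
Qed.

Lemma frechet_cont {n m} (F : Vec n -> Vec m) x J u : frechet F x J -> vcv u x ->
  vcv (fun k => F (u k)) (F x).
Proof. by move=> h cu i; apply: (frechet_s_cont (fun y => F y i)) (frechet_row _ _ _ i h) cu. Qed.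

Lemma hder_line_cont {n} (phi : Vec n -> R) x gr t w w0 : hder phi x gr ->
  (forall k, t k <> 0) -> cv t 0 -> vcv w w0 ->
  cv (fun k => phi (vadd x (vscale (t k) (w k)))) (phi x).
Proof.
move=> h tn ct cw; have := cvD _ _ _ _ (cv_cst (phi x)) (cvM _ _ _ _ ct (h t w w0 tn ct cw)).
by move=> H; apply: cv_ext H _ _ => [k|]; [field | ring].
Qed.

Lemma hder_comp {n m} (phi : Vec m -> R) (F : Vec n -> Vec m) x (J : Mat m n) gr :
  (forall i, hder (fun y => F y i) x (J i)) -> hder phi (F x) gr ->
  hder (fun y => phi (F y)) x (mtv J gr).
Proof.
move=> hF hphi t w w0 tn ct cw; rewrite dot_mtv.
pose p k := vscale (/ t k) (vsub (F (vadd x (vscale (t k) (w k)))) (F x)).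
have cp : vcv p (mv J w0).
  by move=> i; apply: cv_ext (hF i t w w0 tn ct cw) _ _ => // k; rewrite /p /vscale /vsub; field.
apply: cv_ext (hphi t p _ tn ct cp) _ _ => // k.
by have -> : vadd (F x) (vscale (t k) (p k)) = F (vadd x (vscale (t k) (w k))) by rewrite /p; vfield.
Qed.

Lemma hder_sum {n m} (phi : 'I_m -> Vec n -> R) x (gr : 'I_m -> Vec n) :
  (forall i, hder (phi i) x (gr i)) ->
  hder (fun y => vsum (fun i => phi i y)) x (fun a => vsum (fun i => gr i a)).
Proof.
move=> h t w w0 tn ct cw.
have H := cv_sum _ _ (fun i => h i t w w0 tn ct cw).
apply: cv_ext H _ _ => [k|].
  rewrite /Rdiv Rmult_comm /Rminus (_ : - _ = -1 * vsum (fun i => phi i x)); last by ring.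
  by rewrite -vsumZ -vsumD -vsumZ; apply: vsum_ext => i; ring.
rewrite /dot vsum_exchange; apply: vsum_ext => a; rewrite Rmult_comm -vsumZ.
by apply: vsum_ext => i; ring.
Qed.

Lemma hder_mul {n} (phi psi : Vec n -> R) x gr1 gr2 : hder phi x gr1 -> hder psi x gr2 ->
  hder (fun y => phi y * psi y) x (vadd (vscale (psi x) gr1) (vscale (phi x) gr2)).
Proof.
move=> h1 h2 t w w0 tn ct cw.
have H := cvD _ _ _ _ (cvM _ _ _ _ (h1 t w w0 tn ct cw) (hder_line_cont _ _ _ _ _ _ h2 tn ct cw))
  (cvM _ _ _ _ (cv_cst (phi x)) (h2 t w w0 tn ct cw)).
apply: cv_ext H _ _ => [k|]; first by field.
by rewrite dotDl !dotZl; ring.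
Qed.

(** Back from sequences to the epsilon-delta derivative that the mean value theorem requires:
    increments violating the bound would form a sequence tending to 0, contradicting [hder]. *)
Lemma hder_line {n} (phi : Vec n -> R) x v s gr : hder phi (vadd x (vscale s v)) gr ->
  derivable_pt_lim (fun s => phi (vadd x (vscale s v))) s (dot gr v).
Proof.
move=> h eps e0; apply: NNPP => hn.
have [t ht] : exists t, forall k, t k <> 0 /\ Rabs (t k) < / (INR k + 1) /\
    eps <= Rabs ((phi (vadd x (vscale (s + t k) v)) - phi (vadd x (vscale s v))) / t k - dot gr v).
  apply: (choose_seq (fun k t => t <> 0 /\ Rabs t < / (INR k + 1) /\
    eps <= Rabs ((phi (vadd x (vscale (s + t) v)) - phi (vadd x (vscale s v))) / t - dot gr v))) => k.
  apply: NNPP => hk; apply: hn; exists (mkposreal _ (inv_succ_gt0 k)) => d d0 dk.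
  by apply: Rnot_le_lt => le; apply: hk; exists d.
have ct : cv t 0 by apply: cv0_of_le cv_inv_succ => k; apply: Rlt_le; case: (ht k) => _ [].
have /cvP /(_ eps e0) [N HN] := h t (fun _ => v) v (fun k => proj1 (ht k)) ct (vcv_cst v).
have := HN N (leqnn N); have [_ [_]] := ht N.
have -> : vadd (vadd x (vscale s v)) (vscale (t N) v) = vadd x (vscale (s + t N) v) by vring.
lra.
Qed.

Lemma cv_unshift u x N : cv (fun k => u (k + N)%nat) x -> cv u x.
Proof. by move=> h; apply/(is_lim_seq_incr_n u N). Qed.

(** The mean value theorem expresses the remainder through [Dphi] at an intermediate point
    [x + c t w]. With [s = c t], what is left after division by [t ^ 2] is [c] times the gap between
    a difference quotient of [Dphi] at scale [s] and the quadratic form, and this gap tends to 0. *)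
Lemma taylor2 {n} (phi : Vec n -> R) (Dphi : Vec n -> Vec n) x (H : Mat n n) r t w w0 :
  0 < r -> (forall y, vnorm (vsub y x) < r -> hder phi y (Dphi y)) ->
  (forall i, hder (fun y => Dphi y i) x (H i)) ->
  (forall k, 0 < t k) -> cv t 0 -> vcv w w0 ->
  cv (fun k => (phi (vadd x (vscale (t k) (w k))) - phi x - t k * dot (Dphi x) (w k)) / (t k * t k))
     (/ 2 * qform H w0).
Proof.
move=> r0 hphi hD.
(* The whole segment must lie in the ball where [phi] is differentiable; dropping finitely many
   terms ensures it. *)
wlog small : t w / forall k, vnorm (vscale (t k) (w k)) < r.
  move=> wl t0 ct cw.
  have [N HN] : exists N : nat, forall k : nat, (N <= k)%nat -> vnorm (vscale (t k) (w k)) < r.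
    apply: (cv_eventually_lt _ 0) => //.
    have := cv_norm _ _ (vcvZ _ _ _ _ ct cw).
    by rewrite (_ : vscale 0 w0 = vzero) ?vnorm_zero //; vring.
  apply: (cv_unshift _ _ N).
  apply: (wl (fun k => t (k + N)%nat) (fun k => w (k + N)%nat)) => [k|k||].
  - by apply: HN; rewrite leq_addl.
  - exact: t0.
  - exact: cv_shift.
  - exact: vcv_shift.
move=> t0 ct cw.
have [c hc] : exists c, forall k, 0 < c k < 1 /\
    phi (vadd x (vscale (t k) (w k))) - phi x - t k * dot (Dphi x) (w k) =
    / 2 * (t k * t k * qform H (w k)) +
    (t k * dot (Dphi (vadd x (vscale (c k) (vscale (t k) (w k))))) (w k)
      - t k * dot (Dphi x) (w k) - c k * (t k * t k * qform H (w k))).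
  apply: (choose_seq (fun k c => 0 < c < 1 /\
    phi (vadd x (vscale (t k) (w k))) - phi x - t k * dot (Dphi x) (w k) =
    / 2 * (t k * t k * qform H (w k)) +
    (t k * dot (Dphi (vadd x (vscale c (vscale (t k) (w k))))) (w k)
      - t k * dot (Dphi x) (w k) - c * (t k * t k * qform H (w k))))) => k.
  set v := vscale (t k) (w k); set d := t k * dot (Dphi x) (w k).
  set q := t k * t k * qform H (w k).
  (* [psi 1 - psi 0] is the second order remainder along the segment, so a single use of the mean
     value theorem is enough. *)
  pose psi s := phi (vadd x (vscale s v)) - (s * d + / 2 * (s * s * q)).
  have [s hs|c [e hc]] := MVT_cor2 psi (fun s => dot (Dphi (vadd x (vscale s v))) v - (d + s * q))
    0 1 Rlt_0_1.
    apply: derivable_pt_lim_minus.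
      apply: hder_line; apply: hphi; rewrite vsub_addl vnormZ Rabs_pos_eq; last lra.
      have := vnorm_ge0 v; have := small k; rewrite -/v; nra.
    apply/is_derive_Reals; auto_derive => //; field.
  exists c; split=> //; move: e; rewrite /psi.
  have -> : vadd x (vscale 1 v) = vadd x v by vring.
  have -> : vadd x (vscale 0 v) = x by vring.
  rewrite /v dotZr -/v; lra.
pose s k := c k * t k.
have s0 k : 0 < s k by rewrite /s; have := t0 k; have [[]] := hc k; nra.
have cs : cv s 0.
  apply: cv0_of_le ct => k; have := s0 k; have := t0 k; have [[? ?] _] := hc k.
  by rewrite /s => ? ?; rewrite Rabs_pos_eq; nra.
have cD : vcv (fun k => vscale (/ s k) (vsub (Dphi (vadd x (vscale (s k) (w k)))) (Dphi x))) (mv H w0).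
  move=> i; apply: cv_ext (hD i s w w0 _ cs cw) _ _ => // k; last have := s0 k.
    by have := s0 k; lra.
  by rewrite /vscale /vsub => ?; field; lra.
have cq : cv (fun k => qform H (w k)) (qform H w0) by apply: cv_dot => //; apply: vcv_mv.
have c1 := cvB _ _ _ _ (cv_dot _ _ _ _ cD cw) cq.
rewrite [dot (mv H w0) w0]dotC -/(qform H w0) Rminus_diag in c1.
have c2 : cv (fun k => c k * (dot (vscale (/ s k) (vsub (Dphi (vadd x (vscale (s k) (w k)))) (Dphi x))) (w k)
   - qform H (w k))) 0.
  apply: (cv0_of_le _ _ _ (cv_ext _ _ _ _ (is_lim_seq_abs _ _ c1) (fun k => erefl) Rabs_R0)) => k.
  rewrite Rabs_mult; have [[? ?] _] := hc k.
  rewrite (Rabs_pos_eq (c k)); last lra.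
  have := Rabs_pos (dot (vscale (/ s k) (vsub (Dphi (vadd x (vscale (s k) (w k)))) (Dphi x))) (w k)
     - qform H (w k)); nra.
apply: cv_ext (cvD _ _ _ _ (cvM _ _ _ _ (cv_cst (/ 2)) cq) c2) _ _ => [k|]; last by ring.
have [hk ->] := hc k.
have -> : vscale (c k) (vscale (t k) (w k)) = vscale (s k) (w k) by rewrite /s; vring.
rewrite dotZl dotBl /s; field.
have := t0 k; lra.
Qed.

(** * Bounded multipliers for regular subgradients *)

Lemma cv_bounded u x : cv u x -> exists B, forall k, Rabs (u k) <= B.
Proof.
move=> /is_lim_seq_Reals h; have [B [_ hB]] := maj_by_pos u (exist _ x h).
by exists B.
Qed.

Lemma Rle_of_eps a b c : 0 <= c -> (forall eps, 0 < eps -> a <= b + c * eps) -> a <= b.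
Proof.
move=> c0 h; apply: Rnot_lt_le => lt.
have := h ((a - b) / (2 * (c + 1))) ltac:(apply: Rdiv_lt_0_compat; lra).
have -> : c * ((a - b) / (2 * (c + 1))) = (a - b) * (c / (2 * (c + 1))) by field; lra.
have : c / (2 * (c + 1)) <= / 2.
  apply: (Rmult_le_reg_r (2 * (c + 1))); first lra.
  by have -> : c / (2 * (c + 1)) * (2 * (c + 1)) = c; [field; lra | lra].
nra.
Qed.

(* [r] is the residual of the projection of [y] onto the closure of [P]; [P] need not be closed. *)
Lemma cone_residual {l} (P : Vec l -> Prop) y : (exists p, P p) -> is_convex P -> is_cone P ->
  exists r, [/\ forall p, P p -> dot r p <= 0, dot r y = vnorm r * vnorm r &
    forall eps, 0 < eps -> exists p, P p /\ vnorm (vsub y p) <= vnorm r + eps].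
Proof.
move=> [p0 Pp0] vP cP.
have P0 : P vzero by have := cP _ 0 Pp0 (Rle_refl 0); rewrite (_ : vscale 0 p0 = vzero) //; vring.
pose Q p := forall eps, 0 < eps -> exists p', P p' /\ vnorm (vsub p p') < eps.
have PQ p : P p -> Q p.
  by move=> Pp eps e0; exists p; split=> //; rewrite vsubvv vnorm_zero.
have [|||p [Qp hp]] := exists_proj Q y.
- by exists vzero; apply: PQ.
- move=> u x hu cu eps e0; have [N HN] := cu (eps / 2) ltac:(lra).
  have [p' [Pp' hp']] := hu N (eps / 2) ltac:(lra).
  exists p'; split=> //; have := vnorm_tri (u N) x p'; have := HN N (leqnn N).
  by rewrite (vnorm_subC (u N) x); lra.
- move=> a b t Qa Qb ht eps e0.
  have [a' [Pa ha]] := Qa _ e0; have [b' [Pb hb]] := Qb _ e0.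
  exists (vadd (vscale t a') (vscale (1 - t) b')); split; first exact: vP.
  have -> : vsub (vadd (vscale t a) (vscale (1 - t) b)) (vadd (vscale t a') (vscale (1 - t) b'))
     = vadd (vscale t (vsub a a')) (vscale (1 - t) (vsub b b')) by vring.
  apply: Rle_lt_trans (vnormD _ _) _; rewrite !vnormZ !Rabs_pos_eq; try lra.
  have [->|tp] := Req_dec t 0; first lra.
  have := vnorm_ge0 (vsub b b'); nra.
pose r := vsub y p.
have rp0 : 0 <= dot r p by have := hp _ (PQ _ P0); rewrite -/r dotBr dot0r; lra.
have rP x : P x -> dot r x <= 0.
  move=> Px; apply: Rnot_lt_le => lt.
  have s0 : 0 <= (dot r p + 1) / dot r x by apply: Rlt_le; apply: Rdiv_lt_0_compat; lra.
  have := hp _ (PQ _ (cP _ _ Px s0)); rewrite -/r dotBr dotZr.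
  have -> : (dot r p + 1) / dot r x * dot r x = dot r p + 1 by field; lra.
  lra.
have rp : dot r p <= 0.
  apply: (Rle_of_eps _ _ (vnorm r)); first exact: vnorm_ge0.
  move=> eps e0; have [p' [Pp' hp']] := Qp _ e0.
  have := dot_le_norm r (vsub p p'); rewrite dotBr; have := rP _ Pp'.
  have := vnorm_ge0 r; nra.
exists r; split=> //.
  rewrite vnorm_sq {3}/r dotBr; lra.
move=> eps e0; have [p' [Pp' hp']] := Qp _ e0; exists p'; split=> //.
have := vnorm_tri p y p'; rewrite -/r; lra.
Qed.

(** Let [D] be the set of all [mtv A mu] with [mu] in the polar of [P] and [|mu| <= k]. Its support
    function at [w] is [k] times the distance from [A w] to [P], so the hypothesis places [v0] below
    this support function. As [D] is convex and compact, [v0] belongs to it. *)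
Lemma bounded_multiplier {n l} (A : Mat l n) (P : Vec l -> Prop) v0 k :
  (exists p, P p) -> is_convex P -> is_cone P -> 0 <= k ->
  (forall w p, P p -> dot v0 w <= k * vnorm (vsub (mv A w) p)) ->
  exists mu, [/\ forall p, P p -> dot mu p <= 0, v0 = mtv A mu & vnorm mu <= k].
Proof.
move=> P0 vP cP k0 hv.
pose D v := exists mu, [/\ forall p, P p -> dot mu p <= 0, v = mtv A mu & vnorm mu <= k].
have [|||d [Dd hd]] := exists_proj D v0.
- exists (mtv A vzero), vzero; split=> // [p _|]; first by rewrite dot0l; lra.
  by rewrite vnorm_zero.
- move=> u x hu /seq_convP cu; have [mu hmu] := choose_seq _ hu.
  have [th [hth [m cm]]] := bounded_subseq mu k (fun j => let: And3 _ _ h := hmu j in h).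
  exists m; split.
  + move=> p Pp; apply: cv_le _ (cv_dot _ _ _ _ cm (vcv_cst p)) (cv_cst 0) => j.
    by case: (hmu (th j)) => h _ _; apply: h.
  + apply: functional_extensionality => i.
    apply: cv_unique (vcv_subseq th _ _ hth cu i) _.
    apply: cv_ext (vcv_mtv A _ _ cm i) _ _ => // j.
    by case: (hmu (th j)) => _ -> _.
  + apply: cv_le _ (cv_norm _ _ cm) (cv_cst k) => j.
    by case: (hmu (th j)).
- move=> _ _ t [a [ha -> na]] [b [hb -> nb]] ht; exists (vadd (vscale t a) (vscale (1 - t) b)); split.
  + move=> p Pp; rewrite dotDl !dotZl; have := ha _ Pp; have := hb _ Pp; nra.
  + by rewrite mtvD !mtvZ.
  + apply: Rle_trans (vnormD _ _) _; rewrite !vnormZ !Rabs_pos_eq; try lra; nra.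
suff e : v0 = d by rewrite e.
pose w := vsub v0 d.
have [r [rP ry hr]] := cone_residual P (mv A w) P0 vP cP.
(* The normalised residual [k r / |r|] attains the support function of [D] in the direction [w]; for
   [r = 0] the value is 0 and [mu = 0] attains it. *)
have [mu [muP nmu muy]] : exists mu, [/\ forall p, P p -> dot mu p <= 0, vnorm mu <= k &
    dot mu (mv A w) = k * vnorm r].
  have r0 := vnorm_ge0 r.
  have [e|ne] := Req_dec (vnorm r) 0.
    exists vzero; rewrite vnorm_zero dot0l e; split=> // [p _|]; last ring.
    by rewrite dot0l; lra.
  have c0 : 0 <= k / vnorm r by apply: Rle_mult_inv_pos; lra.
  exists (vscale (k / vnorm r) r); split.
  + move=> p Pp; rewrite dotZl; have := rP _ Pp; nra.
  + rewrite vnormZ Rabs_pos_eq // (_ : k / vnorm r * vnorm r = k); last by field.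
    lra.
  + by rewrite dotZl ry; field.
have := hd _ (ex_intro _ mu (And3 muP erefl nmu)); rewrite -/w dotBr (dotC w (mtv A mu)) dot_mtv muy => h1.
have h2 : dot v0 w <= k * vnorm r.
  apply: (Rle_of_eps _ _ k) => // eps e0; have [p [Pp hp]] := hr _ e0.
  have := hv w p Pp; nra.
have : dot w w <= 0.
  rewrite {1}/w dotBl (dotC d w); lra.
rewrite -vnorm_sq => h3.
have w0 : vnorm w = 0 by have := vnorm_ge0 w; nra.
have := vnorm0_eq _ w0; rewrite /w => e; apply: functional_extensionality => i.
by have := congr1 (fun f => f i) e; rewrite /vsub /vzero; lra.
Qed.

Section FirstOrder.

Variables (n l : nat) (g : Vec n -> R) (Gam : Vec n -> Prop) (f : Vec n -> option R).
Variables (G : Vec n -> Vec l) (C : Vec l -> Prop) (x dg : Vec n) (A : Mat l n) (rad kap : R).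
Hypothesis fE : forall y a, f y = Some a <-> Gam y /\ a = g y.
Hypothesis rad0 : 0 < rad.
Hypothesis kap0 : 0 < kap.
Hypothesis gder : hder g x dg.
Hypothesis Gder : forall i, hder (fun y => G y i) x (A i).
Hypothesis Ccv : is_convex C.
Hypothesis Ccone : is_cone C.
Hypothesis CG : C (G x).
(** Metric subregularity with both distances unfolded: [c] is any nearby competitor in [C], and
    [eps] replaces the choice of a nearest feasible point. *)
Hypothesis MS : forall y c, vnorm (vsub y x) < rad -> C c -> vnorm (vsub (G y) c) < rad ->
  forall eps, 0 < eps -> exists y', Gam y' /\ vnorm (vsub y y') < kap * vnorm (vsub (G y) c) + eps.

Lemma cone_add c d : C c -> C d -> C (vadd c d).
Proof.
move=> Cc Cd; have := Ccone _ 2 (Ccv _ _ (/ 2) Cc Cd ltac:(lra)) ltac:(lra).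
by have -> : vscale 2 (vadd (vscale (/ 2) c) (vscale (1 - / 2) d)) = vadd c d by vfield.
Qed.

(** With [p = c - s G(x)], the point [G x + t p = (1 - t s) G x + t c] stays in [C] for small [t].
    Subregularity then moves [x + t w] to a feasible [x + t w'] with [|w - w'|] at most
    [kap |A w - p|] in the limit. Along a limit [u] of the [w'], the subgradient inequality gives
    [<v - dg, u> <= 0], and Cauchy-Schwarz bounds the rest. *)
Lemma subgradient_bound v w c s : reg_subdiff f x v -> C c -> 0 <= s ->
  dot (vsub v dg) w <=
  kap * vnorm (vsub v dg) * vnorm (vsub (mv A w) (vsub c (vscale s (G x)))).
Proof.
move=> [fx [/fE [_ ->] hreg]] Cc s0.
set p := vsub c _.
pose t k := / (INR k + 1).
have t0 k : 0 < t k := inv_succ_gt0 k.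
have ct : cv t 0 := cv_inv_succ.
pose e k := vnorm (vsub (vscale (/ t k) (vsub (G (vadd x (vscale (t k) w))) (G x))) p).
have ce : cv e (vnorm (vsub (mv A w) p)).
  apply: cv_norm; apply: vcvB; last exact: vcv_cst.
  move=> i; apply: cv_ext (Gder i t (fun _ => w) w _ ct (vcv_cst w)) _ _ => // k.
    by have := t0 k; lra.
  by rewrite /vscale /vsub /Rdiv Rmult_comm.
have [N1 H1] : exists N : nat, forall k : nat, (N <= k)%nat -> t k * vnorm w < rad.
  apply: (cv_eventually_lt _ 0) => //.
  by have := cvM _ _ _ _ ct (cv_cst (vnorm w)); rewrite Rmult_0_l.
have [N2 H2] : exists N : nat, forall k : nat, (N <= k)%nat -> t k * e k < rad.
  apply: (cv_eventually_lt _ 0) => //.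
  by have := cvM _ _ _ _ ct ce; rewrite Rmult_0_l.
have [N3 H3] : exists N : nat, forall k : nat, (N <= k)%nat -> t k * s < 1.
  apply: (cv_eventually_lt _ 0); last lra.
  by have := cvM _ _ _ _ ct (cv_cst s); rewrite Rmult_0_l.
pose N := maxn N1 (maxn N2 N3).
have [w' hw'] : exists w', forall k, Gam (vadd x (vscale (t (k + N)%nat) (w' k))) /\
    vnorm (vsub w (w' k)) <= kap * e (k + N)%nat + t (k + N)%nat.
  apply: (choose_seq (fun k w' => Gam (vadd x (vscale (t (k + N)%nat) w')) /\
    vnorm (vsub w w') <= kap * e (k + N)%nat + t (k + N)%nat)) => k.
  have := leq_addl k N; move: (k + N)%nat => j; rewrite !geq_max => /andP [/H1 j1 /andP [/H2 j2 /H3 j3]].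
  have tj := t0 j.
  have E : vnorm (vsub (G (vadd x (vscale (t j) w))) (vadd (G x) (vscale (t j) p))) = t j * e j.
    have -> : vsub (G (vadd x (vscale (t j) w))) (vadd (G x) (vscale (t j) p)) = vscale (t j)
      (vsub (vscale (/ t j) (vsub (G (vadd x (vscale (t j) w))) (G x))) p) by vfield; lra.
    by rewrite vnormZ Rabs_pos_eq //; lra.
  (* The slack [t j * t j] is still negligible after division by [t j]. *)
  have [||||y' [Gy' hy']] := MS (vadd x (vscale (t j) w)) (vadd (G x) (vscale (t j) p)) _ _ _ (t j * t j).
  - by rewrite vsub_addl vnormZ Rabs_pos_eq //; lra.
  - have -> : vadd (G x) (vscale (t j) p) = vadd (vscale (1 - t j * s) (G x)) (vscale (t j) c).
      by rewrite /p; vring.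
    apply: cone_add; apply: Ccone => //; lra.
  - by rewrite E.
  - nra.
  exists (vscale (/ t j) (vsub y' x)).
  have -> : vadd x (vscale (t j) (vscale (/ t j) (vsub y' x))) = y' by vfield; lra.
  split=> //; apply: (Rmult_le_reg_l (t j)) => //.
  have ey : vsub (vadd x (vscale (t j) w)) y' = vscale (t j) (vsub w (vscale (/ t j) (vsub y' x))).
    by vfield; lra.
  by move: hy'; rewrite E ey vnormZ Rabs_pos_eq; lra.
have cb := cvD _ _ _ _ (cvM _ _ _ _ (cv_cst kap) (cv_shift _ _ N ce)) (cv_shift _ _ N ct).
have [B hB] := cv_bounded _ _ cb.
have [|th [hth [u cu]]] := bounded_subseq w' (vnorm w + B).
  move=> k; have [_ h] := hw' k.
  have -> : w' k = vsub (vsub w vzero) (vsub w (w' k)) by vring.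
  have := vnorm_tri vzero (vsub w vzero) (vsub w (w' k)).
  rewrite (vnorm_subC vzero).
  have ee v' : vsub v' vzero = v' :> Vec n by vring.
  by rewrite !ee; have := hB k; split_Rabs; lra.
have wu : vnorm (vsub w u) <= kap * vnorm (vsub (mv A w) p).
  apply: (cv_le _ _ _ _ (fun k => proj2 (hw' (th k))) (cv_norm _ _ (vcvB _ _ _ _ (vcv_cst w) cu))).
  by have := cv_subseq th _ _ hth cb; rewrite Rplus_0_r.
pose tk k := t (th k + N)%nat.
have ctk : cv tk 0 := cv_subseq th _ _ hth (cv_shift _ _ N ct).
have tk0 k : 0 < tk k := t0 _.
have tkn k : tk k <> 0 by have := tk0 k; lra.
have vu : dot (vsub v dg) u <= 0.
  apply: (Rle_of_eps _ _ (vnorm u)); first exact: vnorm_ge0.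
  move=> eps e0; have [del [d0 hdel]] := hreg _ e0.
  have /seq_convP cx := vcv_vadd_vscale x tk _ _ ctk cu.
  have [M HM] := cx _ d0.
  have h k : dot v (w' (th (k + M)%nat)) - eps * vnorm (w' (th (k + M)%nat)) <=
     (g (vadd x (vscale (tk (k + M)%nat) (w' (th (k + M)%nat)))) - g x) / tk (k + M)%nat.
    have := HM (k + M)%nat (leq_addl _ _); move: (k + M)%nat => j hj.
    have := hdel _ (g (vadd x (vscale (tk j) (w' (th j))))) hj.
    have hG := proj1 (hw' (th j)).
    have hf : f (vadd x (vscale (tk j) (w' (th j)))) = Some (g (vadd x (vscale (tk j) (w' (th j))))).
      by apply/fE.
    move=> /(_ hf); rewrite vsub_addl dotZr vnormZ Rabs_pos_eq; last by apply: Rlt_le.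
    move=> H; apply: (Rmult_le_reg_l (tk j)) => //.
    have -> : tk j * ((g (vadd x (vscale (tk j) (w' (th j)))) - g x) / tk j)
      = g (vadd x (vscale (tk j) (w' (th j)))) - g x by field.
    lra.
  have := cv_le _ _ _ _ h
    (cv_shift _ _ M (cvB _ _ _ _ (cv_dot _ _ _ _ (vcv_cst v) cu) (cvM _ _ _ _ (cv_cst eps) (cv_norm _ _ cu))))
    (cv_shift _ _ M (gder tk _ _ tkn ctk cu)).
  rewrite dotBl; lra.
have := dot_le_norm (vsub v dg) (vsub w u); rewrite dotBr.
have := vnorm_ge0 (vsub v dg); nra.
Qed.

Lemma reg_subdiff_multiplier v : reg_subdiff f x v ->
  exists mu, [/\ forall c, C c -> dot mu c <= 0, dot mu (G x) = 0,
    vsub v dg = mtv A mu & vnorm mu <= kap * vnorm (vsub v dg)].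
Proof.
move=> hv.
(* The polar of this cone is the normal cone to [C] at [G x]: testing with [c] gives polarity to
   [C], and testing with [- G x] gives complementarity. The cone need not be closed. *)
pose P p := exists c s, [/\ C c, 0 <= s & p = vsub c (vscale s (G x))].
have C0 : C vzero by have := Ccone _ 0 CG (Rle_refl 0); rewrite (_ : vscale 0 (G x) = vzero) //; vring.
have [||||w p|mu [muP e nmu]] := bounded_multiplier A P (vsub v dg) (kap * vnorm (vsub v dg)).
- by exists vzero, vzero, 0; split=> //; [lra | vring].
- move=> _ _ t [c [s [Cc s0 ->]]] [c' [s' [Cc' s0' ->]]] ht.
  exists (vadd (vscale t c) (vscale (1 - t) c')), (t * s + (1 - t) * s'); split; last by vring.
    exact: Ccv.
  nra.
- move=> _ t [c [s [Cc s0 ->]]] t0; exists (vscale t c), (t * s); split; last by vring.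
    exact: Ccone.
  nra.
- have := vnorm_ge0 (vsub v dg); nra.
- by move=> [c [s [Cc s0 ->]]]; apply: subgradient_bound.
have muC c : C c -> dot mu c <= 0.
  by move=> Cc; apply: muP; exists c, 0; split=> //; [lra | vring].
exists mu; split=> //.
have := muC _ CG.
have := muP (vsub vzero (vscale 1 (G x))) (ex_intro _ vzero (ex_intro _ 1 (And3 C0 Rle_0_1 erefl))).
rewrite dotBr dot0r dotZr; lra.
Qed.

End FirstOrder.

(** * Graphical derivative of the subdifferential *)

Lemma mv_lincomb {l a b} (D : 'I_l -> Mat a b) (mu : Vec l) w :
  mv (fun i j => vsum (fun k => mu k * D k i j)) w = fun i => vsum (fun k => mu k * mv (D k) w i).
Proof.
apply: functional_extensionality => i; rewrite /mv.
under [RHS]vsum_ext do rewrite -vsumZ.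
rewrite vsum_exchange; apply: vsum_ext => j; rewrite Rmult_comm -vsumZ.
by apply: vsum_ext => k; ring.
Qed.

Lemma qform_lincomb {l n} (D : 'I_l -> Mat n n) (mu : Vec l) w :
  qform (fun i j => vsum (fun k => mu k * D k i j)) w = dot mu (fun k => qform (D k) w).
Proof.
rewrite /qform mv_lincomb /dot; under vsum_ext do rewrite -vsumZ.
rewrite vsum_exchange; apply: vsum_ext => k; rewrite -vsumZ.
by apply: vsum_ext => a; ring.
Qed.

Section SecondOrder.

Variables (n l : nat) (g : Vec n -> R) (Dg : Vec n -> Vec n) (H : Mat n n).
Variables (Gam : Vec n -> Prop) (f : Vec n -> option R).
Variables (G : Vec n -> Vec l) (DG : Vec n -> Mat l n) (D2G : 'I_l -> Mat n n).
Variables (C : Vec l -> Prop) (xb : Vec n) (rad kap : R).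
Hypothesis fE : forall y a, f y = Some a <-> Gam y /\ a = g y.
Hypothesis rad0 : 0 < rad.
Hypothesis kap0 : 0 < kap.
Hypothesis Hg1 : forall x, frechet_s g x (Dg x).
Hypothesis Hg2 : frechet Dg xb H.
Hypothesis HG1 : forall x, vnorm (vsub x xb) < rad -> forall i, hder (fun y => G y i) x (DG x i).
Hypothesis HG2 : forall i a, hder (fun x => DG x i a) xb (D2G i a).
Hypothesis G0 : G xb = vzero.
Hypothesis GamC : forall x, vnorm (vsub x xb) < rad -> (Gam x <-> C (G x)).
Hypothesis Gamxb : Gam xb.
Hypothesis Gamcl : is_closed Gam.
Hypothesis Ccl : is_closed C.
Hypothesis Ccv : is_convex C.
Hypothesis Ccone : is_cone C.
Hypothesis MS : forall y c, vnorm (vsub y xb) < rad -> C c -> vnorm (vsub (G y) c) < rad ->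
  forall eps, 0 < eps -> exists y', Gam y' /\ vnorm (vsub y y') < kap * vnorm (vsub (G y) c) + eps.

Let A := DG xb.

(** Since [G xb = 0], the normal cone to [C] at this point is the whole polar of [C]; these are the
    multipliers of the reduced problem. *)
Definition multiplier (mu : Vec l) :=
  (forall c, C c -> dot mu c <= 0) /\ vadd (Dg xb) (mtv A mu) = vzero.
Definition hessM (mu : Vec l) : Mat n n := fun a b => H a b + vsum (fun i => mu i * D2G i a b).
Definition critical (w : Vec n) := tcone Gam xb w /\ dot (Dg xb) w = 0.

Lemma mv_hessM mu w :
  mv (hessM mu) w = vadd (mv H w) (fun a => vsum (fun i => mu i * mv (D2G i) w a)).
Proof.
rewrite -mv_lincomb; apply: functional_extensionality => a; rewrite /vadd /mv /hessM -vsumD.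
by apply: vsum_ext => b; ring.
Qed.

Lemma qform_hessM mu w :
  qform (hessM mu) w = qform H w + dot mu (fun i => qform (D2G i) w).
Proof. by rewrite -qform_lincomb /qform mv_hessM dotDr mv_lincomb. Qed.

Lemma cv_mul0 (t u : nat -> R) x : cv t 0 -> cv u x -> cv (fun k => t k * u k) 0.
Proof. by move=> h1 h2; have := cvM _ _ _ _ h1 h2; rewrite Rmult_0_l. Qed.

Lemma scaled_small (t : nat -> R) (w : nat -> Vec n) w0 r : 0 < r -> cv t 0 -> vcv w w0 ->
  exists N : nat, forall k : nat, (N <= k)%nat ->
    vnorm (vsub (vadd xb (vscale (t k) (w k))) xb) < r.
Proof.
by move=> r0 ct cw; have /seq_convP /(_ r r0) := vcv_vadd_vscale xb t w w0 ct cw.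
Qed.

Lemma G_quotient t w w0 : (forall k, 0 < t k) -> cv t 0 -> vcv w w0 ->
  vcv (fun k => vscale (/ t k) (G (vadd xb (vscale (t k) (w k))))) (mv A w0).
Proof.
move=> t0 ct cw i.
have xx : vnorm (vsub xb xb) < rad by rewrite vsubvv vnorm_zero.
apply: cv_ext (HG1 xb xx i t w w0 _ ct cw) _ _ => // k; have := t0 k; first lra.
by move=> ?; rewrite G0 /vscale /vzero; field; lra.
Qed.

Lemma G_taylor2 t w w0 : (forall k, 0 < t k) -> cv t 0 -> vcv w w0 ->
  vcv (fun k => vscale (/ (t k * t k))
         (vsub (G (vadd xb (vscale (t k) (w k)))) (vscale (t k) (mv A (w k)))))
      (vscale (/ 2) (fun i => qform (D2G i) w0)).
Proof.
move=> t0 ct cw i.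
apply: cv_ext (taylor2 (fun y => G y i) (fun y => DG y i) xb (D2G i) rad t w w0 rad0
  (fun y hy => HG1 y hy i) (HG2 i) t0 ct cw) _ _ => // k.
rewrite G0 /vscale /vsub /vzero -/(mv A (w k) i) /Rdiv Rmult_comm; congr Rmult.
by rewrite Rminus_0_r.
Qed.

Lemma g_taylor2 t w w0 : (forall k, 0 < t k) -> cv t 0 -> vcv w w0 ->
  cv (fun k => (g (vadd xb (vscale (t k) (w k))) - g xb - t k * dot (Dg xb) (w k)) / (t k * t k))
     (/ 2 * qform H w0).
Proof.
apply: (taylor2 g Dg xb H 1) => //; first lra.
- by move=> y _; apply: frechet_s_hder.
- by move=> i; apply: frechet_hder.
Qed.

Lemma tangent_image u : tcone Gam xb u -> C (mv A u).
Proof.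
move=> [t [w [t0 [/is_lim_seq_Reals ct [/seq_convP cw hG]]]]].
have [N HN] := scaled_small t w u rad rad0 ct cw.
apply: (Ccl (fun k => vscale (/ t (k + N)%nat) (G (vadd xb (vscale (t (k + N)%nat) (w (k + N)%nat)))))).
  move=> k; apply: Ccone; last by apply/Rlt_le/Rinv_0_lt_compat.
  by apply/GamC => //; apply: HN; rewrite leq_addl.
apply/seq_convP; exact: (vcv_shift _ _ N (G_quotient t w u t0 ct cw)).
Qed.

(** The base subgradient is zero, so [t k * zk k] is itself a regular subgradient at the k-th point;
    [ms_stat] is its multiplier equation and [ms_compl] its complementarity. *)
Record multiplier_seq (w z : Vec n) (mu : Vec l) (t : nat -> R) (wk zk : nat -> Vec n)
    (muk : nat -> Vec l) : Prop := MultiplierSeq {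
  ms_t0 : forall k, 0 < t k; ms_ct : cv t 0; ms_cw : vcv wk w; ms_cz : vcv zk z;
  ms_cmu : vcv muk mu;
  ms_Gam : forall k, Gam (vadd xb (vscale (t k) (wk k)));
  ms_C : forall k, C (G (vadd xb (vscale (t k) (wk k))));
  ms_polar : forall k c, C c -> dot (muk k) c <= 0;
  ms_compl : forall k, dot (muk k) (G (vadd xb (vscale (t k) (wk k)))) = 0;
  ms_stat : forall k, vsub (vscale (t k) (zk k)) (Dg (vadd xb (vscale (t k) (wk k)))) =
                      mtv (DG (vadd xb (vscale (t k) (wk k)))) (muk k) }.

(** The vectors [t k * zk k - Dg(x_k)] converge to [- Dg xb], so the uniform multiplier bound makes
    [muk] bounded and passes to its limit. That limit bound does not depend on [w] or [z], as
    [critical_dom] requires. *)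
Lemma exists_multiplier_seq w z : tcone2 (lim_subdiff f) xb vzero w z ->
  exists mu t wk zk muk,
    multiplier_seq w z mu t wk zk muk /\ vnorm mu <= kap * vnorm (Dg xb).
Proof.
move=> /tcone2_lim_subdiff [t [wk [zk [t0 [/is_lim_seq_Reals ct [/seq_convP cw [/seq_convP cz hS]]]]]]].
(* The first order result is applied at [x j], and its ball of radius [rad / 2] must stay inside the
   ball of radius [rad] around [xb]. *)
have r2 : 0 < rad / 2 by lra.
have [N HN] := scaled_small t wk w _ r2 ct cw.
pose x k := vadd xb (vscale (t k) (wk k)).
have hGam k : Gam (x k) by case: (hS k) => fx [/fE []].
have [muk hmu] : exists muk, forall k, [/\ forall c, C c -> dot (muk k) c <= 0,
    dot (muk k) (G (x (k + N)%nat)) = 0,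
    vsub (vadd vzero (vscale (t (k + N)%nat) (zk (k + N)%nat))) (Dg (x (k + N)%nat)) =
       mtv (DG (x (k + N)%nat)) (muk k) &
    vnorm (muk k) <= kap * vnorm (vsub (vadd vzero (vscale (t (k + N)%nat) (zk (k + N)%nat)))
       (Dg (x (k + N)%nat)))].
  apply: (choose_seq (fun k mu => [/\ forall c, C c -> dot mu c <= 0,
    dot mu (G (x (k + N)%nat)) = 0,
    vsub (vadd vzero (vscale (t (k + N)%nat) (zk (k + N)%nat))) (Dg (x (k + N)%nat)) =
       mtv (DG (x (k + N)%nat)) mu &
    vnorm mu <= kap * vnorm (vsub (vadd vzero (vscale (t (k + N)%nat) (zk (k + N)%nat)))
       (Dg (x (k + N)%nat)))])) => k.
  have := leq_addl k N; move: (k + N)%nat => j /HN; rewrite -/(x j) => hx.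
  apply: (reg_subdiff_multiplier n l g Gam f G C (x j) _ _ (rad / 2) kap) => //.
  - exact: frechet_s_hder.
  - by apply: HG1; lra.
  - by apply/GamC => //; lra.
  - move=> y c hy Cc hc; apply: MS => //; last lra.
    have := vnorm_tri (x j) y xb; lra.
  - exact: hS.
have cx : vcv x xb := vcv_vadd_vscale xb t wk w ct cw.
have cv1 : vcv (fun k => vsub (vadd vzero (vscale (t k) (zk k))) (Dg (x k))) (vsub vzero (Dg xb)).
  apply: vcvB; last exact: frechet_cont Hg2 cx.
  by apply: (vcv_ext _ _ _ _ (vcvZ _ _ _ _ ct cz)); [move=> ?|]; vring.
have cn := cvM _ _ _ _ (cv_cst kap) (cv_norm _ _ (vcv_shift _ _ N cv1)).
have [B hB] := cv_bounded _ _ cn.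
have [|th [hth [mu cmu]]] := bounded_subseq muk B.
  move=> k; case: (hmu k) => _ _ _ h; apply: Rle_trans h _.
  exact: Rle_trans (Rle_abs _) (hB k).
exists mu, (fun k => t (th k + N)%nat), (fun k => wk (th k + N)%nat), (fun k => zk (th k + N)%nat),
  (fun k => muk (th k)); split; last first.
  have : vnorm mu <= kap * vnorm (vsub vzero (Dg xb)).
    apply: cv_le _ (cv_norm _ _ cmu) (cv_subseq th _ _ hth cn) => k.
    by case: (hmu (th k)).
  rewrite vnorm_subC (_ : vsub (Dg xb) vzero = Dg xb) //; vring.
split=> //.
- exact: (cv_subseq th _ _ hth (cv_shift _ _ N ct)).
- exact: (vcv_subseq th _ _ hth (vcv_shift _ _ N cw)).
- exact: (vcv_subseq th _ _ hth (vcv_shift _ _ N cz)).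
- by move=> k; apply: hGam.
- move=> k; apply: (proj1 (GamC _ _)); last exact: hGam.
  by apply: Rlt_trans (HN _ (leq_addl _ _)) _; lra.
- by move=> k; case: (hmu (th k)).
- by move=> k; case: (hmu (th k)).
- move=> k; case: (hmu (th k)) => _ _ <- _; rewrite /x; congr vsub; vring.
Qed.

Section Limits.

Variables (w z : Vec n) (mu : Vec l) (t : nat -> R) (wk zk : nat -> Vec n) (muk : nat -> Vec l).
Hypothesis ms : multiplier_seq w z mu t wk zk muk.

Let x k := vadd xb (vscale (t k) (wk k)).
Let t0 := ms_t0 _ _ _ _ _ _ _ ms.
Let ct := ms_ct _ _ _ _ _ _ _ ms.
Let cw := ms_cw _ _ _ _ _ _ _ ms.
Let cmu := ms_cmu _ _ _ _ _ _ _ ms.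
Let tn k : t k <> 0. Proof. by have := t0 k; lra. Qed.
Let eta := vsub z (mv (hessM mu) w).
Let etak k := vscale (/ t k) (vadd (mtv A (muk k)) (Dg xb)).

(** [etak] is the stationarity residual of [muk k] at the fixed point [xb], divided by [t k].
    Subtracting it from the equation at the moving point leaves difference quotients of [Dg] and
    [DG], whose limits make up [hessM mu] applied to [w]. *)
Lemma etak_cv : vcv etak eta.
Proof.
have c1 : vcv (fun k => vscale (/ t k) (vsub (Dg (x k)) (Dg xb))) (mv H w).
  move=> a; apply: cv_ext (frechet_hder _ _ _ a Hg2 t wk w tn ct cw) _ _ => // k.
  by rewrite /vscale /vsub /Rdiv Rmult_comm.
have c2 : vcv (fun k a => vsum (fun i => muk k i * (/ t k * (DG (x k) i a - A i a))))
    (fun a => vsum (fun i => mu i * mv (D2G i) w a)).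
  move=> a; apply: cv_sum => i; apply: cvM; first exact: cmu.
  apply: cv_ext (HG2 i a t wk w tn ct cw) _ _ => // k.
  by rewrite /Rdiv Rmult_comm.
have := vcvB _ _ _ _ (vcvB _ _ _ _ (ms_cz _ _ _ _ _ _ _ ms) c1) c2.
move=> h; apply: vcv_ext h _ _ => [k|]; last by rewrite /eta mv_hessM; vring.
apply: functional_extensionality => a.
have e : t k * zk k a - Dg (x k) a = mtv (DG (x k)) (muk k) a :=
  congr1 (fun v => v a) (ms_stat _ _ _ _ _ _ _ ms k).
have E : vsum (fun i => muk k i * (/ t k * (DG (x k) i a - A i a)))
    = / t k * (mtv (DG (x k)) (muk k) a - mtv A (muk k) a).
  rewrite /mtv /Rminus (_ : - vsum (fun i => A i a * muk k i) = -1 * vsum (fun i => A i a * muk k i)); last by ring.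
  by rewrite -vsumZ -vsumD -vsumZ; apply: vsum_ext => i; ring.
rewrite /vsub E -e /etak /vscale /vsub /vadd; field.
exact: tn.
Qed.

Lemma limit_multiplier : multiplier mu.
Proof.
split.
  move=> c Cc; apply: cv_le _ (cv_dot _ _ _ _ cmu (vcv_cst c)) (cv_cst 0) => k.
  exact: ms_polar ms k c Cc.
apply: functional_extensionality => a.
apply: cv_unique (cvD _ _ _ _ (cv_cst (Dg xb a)) (vcv_mtv A _ _ cmu a)) _.
apply: cv_ext (cv_mul0 _ _ _ ct (etak_cv a)) _ _ => // k.
by rewrite /etak /vscale /vadd; field.
Qed.

Lemma multiplier_dot nu u : multiplier nu -> dot (Dg xb) u = - dot nu (mv A u).
Proof.
move=> [_ e]; have := congr1 (fun v => dot v u) e.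
rewrite dotDl dot_mtv dot0l; lra.
Qed.

Lemma limit_critical : critical w.
Proof.
split.
  exists t, wk; split=> //; split; first by apply/is_lim_seq_Reals.
  by split; [apply/seq_convP | exact: ms_Gam ms].
rewrite (multiplier_dot mu); last exact: limit_multiplier.
have := cv_dot _ _ _ _ cmu (G_quotient t wk w t0 ct cw).
move=> h; rewrite (cv_unique _ _ _ h (cv_ext _ _ _ _ (cv_cst 0) _ erefl)); first ring.
by move=> k; rewrite dotZr (ms_compl _ _ _ _ _ _ _ ms); ring.
Qed.

Lemma eta_normal u : critical u -> dot eta u <= 0.
Proof.
move=> [Tu gu]; have Cu := tangent_image u Tu.
apply: cv_le _ (cv_dot _ _ _ _ etak_cv (vcv_cst u)) (cv_cst 0) => k.
rewrite dotZl dotDl dot_mtv gu.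
have := ms_polar _ _ _ _ _ _ _ ms k _ Cu; have := Rinv_0_lt_compat _ (t0 k); nra.
Qed.

(** Pairing [etak] with [wk] leaves [<muk, A wk> / t]. Because [muk] is orthogonal to [G(x_k)], this
    is minus [muk] applied to the second order quotient of [G], which converges. *)
Lemma gradient_quotient_cv :
  cv (fun k => / t k * dot (Dg xb) (wk k))
     (dot eta w + / 2 * dot mu (fun i => qform (D2G i) w)).
Proof.
have h := cvD _ _ _ _ (cv_dot _ _ _ _ etak_cv cw) (cv_dot _ _ _ _ cmu (G_taylor2 t wk w t0 ct cw)).
apply: cv_ext h _ _ => [k|]; last by rewrite dotZr.
rewrite /etak !dotZl dotZr dotDl dot_mtv dotBr (ms_compl _ _ _ _ _ _ _ ms) dotZr.
by field.
Qed.

(** Same computation for a fixed [nu]: its residual at [xb] is exactly 0, but [<nu, G(x_k)>] is only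
    nonpositive, so an inequality remains. *)
Lemma multiplier_le nu : multiplier nu ->
  dot nu (fun i => qform (D2G i) w) <= 2 * dot eta w + dot mu (fun i => qform (D2G i) w).
Proof.
move=> hnu.
have := cv_le _ _ _ _ _ (cv_dot _ _ _ _ (vcv_cst nu) (G_taylor2 t wk w t0 ct cw)) gradient_quotient_cv.
rewrite dotZr => h; suff : / 2 * dot nu (fun i => qform (D2G i) w) <=
   dot eta w + / 2 * dot mu (fun i => qform (D2G i) w) by lra.
apply: h => k; rewrite (multiplier_dot nu) // dotZr dotBr dotZr.
have := proj1 hnu _ (ms_C _ _ _ _ _ _ _ ms k).
set a := dot nu (G _); set b := dot nu (mv A _) => a0.
have -> : / (t k * t k) * (a - t k * b) = / (t k * t k) * a + / t k * - b by field.
have : 0 < / (t k * t k) by apply: Rinv_0_lt_compat; have := t0 k; nra.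
nra.
Qed.

Lemma eta_dot0 : dot eta w = 0.
Proof.
have := multiplier_le mu limit_multiplier; have := eta_normal w limit_critical; lra.
Qed.

Lemma limit_dot : dot z w = qform (hessM mu) w.
Proof. by have := eta_dot0; rewrite /eta dotBl (dotC (mv _ w)) /qform; lra. Qed.

Lemma limit_maximal nu : multiplier nu -> qform (hessM nu) w <= qform (hessM mu) w.
Proof. by move=> /multiplier_le; rewrite eta_dot0 !qform_hessM; lra. Qed.

(** Adding the expansion of [g] to the limit of [<Dg, wk> / t] gives the limit of
    [(g(x_k) - g(xb)) / t ^ 2], which is half of [<z, w>]. *)
Lemma limit_local_min del : 0 < del ->
  (forall y, Gam y -> vnorm (vsub y xb) < del -> g xb <= g y) -> 0 <= dot z w.
Proof.
move=> d0 hmin; have [N HN] := scaled_small t wk w del d0 ct cw.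
have h := cv_shift _ _ N (cvD _ _ _ _ (g_taylor2 t wk w t0 ct cw) gradient_quotient_cv).
have := cv_le _ _ _ _ _ (cv_cst 0) h.
rewrite eta_dot0 limit_dot qform_hessM => h'.
suff : 0 <= / 2 * qform H w + (0 + / 2 * dot mu (fun i => qform (D2G i) w)) by lra.
apply: h' => k; have := HN (k + N)%nat (leq_addl _ _); move: (k + N)%nat => j hj.
have gj := hmin _ (ms_Gam _ _ _ _ _ _ _ ms j) hj.
set a := g (vadd _ _) in gj *; set b := dot (Dg xb) (wk j).
have -> : (a - g xb - t j * b) / (t j * t j) + / t j * b = (a - g xb) / (t j * t j) by field.
apply: Rle_mult_inv_pos; first lra.
by have := t0 j; nra.
Qed.

End Limits.

Lemma graph_deriv_multiplier w z : tcone2 (lim_subdiff f) xb vzero w z -> exists mu,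
  [/\ multiplier mu, critical w, dot z w = qform (hessM mu) w,
      forall nu, multiplier nu -> qform (hessM nu) w <= qform (hessM mu) w &
      forall del, 0 < del -> (forall y, Gam y -> vnorm (vsub y xb) < del -> g xb <= g y) ->
        0 <= dot z w].
Proof.
move=> /exists_multiplier_seq [mu [t [wk [zk [muk [ms _]]]]]]; exists mu; split.
- exact: limit_multiplier ms.
- exact: limit_critical ms.
- exact: limit_dot ms.
- exact: limit_maximal ms.
- exact: limit_local_min ms.
Qed.

(** On the feasible set [g] dominates [g + <nu, G>], whose gradient vanishes at [xb]. If the bound
    failed for every constant, normalised directions would have a convergent subsequence, along
    which the second order quotients of this function converge and hence cannot be unbounded
    below. *)
Lemma quadratic_lower_bound nu : multiplier nu -> exists c r, [/\ 0 <= c, 0 < r &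
  forall x, Gam x -> vnorm (vsub x xb) < r ->
    g xb - c * (vnorm (vsub x xb) * vnorm (vsub x xb)) <= g x].
Proof.
move=> hnu; apply: NNPP => hn.
have [u hu] : exists u, forall k, [/\ Gam (u k), vnorm (vsub (u k) xb) < / (INR k + 1),
    vnorm (vsub (u k) xb) < rad &
    g (u k) < g xb - INR k * (vnorm (vsub (u k) xb) * vnorm (vsub (u k) xb))].
  apply: (choose_seq (fun k u => [/\ Gam u, vnorm (vsub u xb) < / (INR k + 1),
    vnorm (vsub u xb) < rad &
    g u < g xb - INR k * (vnorm (vsub u xb) * vnorm (vsub u xb))])) => k.
  apply: NNPP => hk; apply: hn; exists (INR k), (Rmin (/ (INR k + 1)) rad); split.
  - exact: pos_INR.
  - by apply: Rmin_pos => //; apply: inv_succ_gt0.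
  - move=> y Gy hy; apply: Rnot_lt_le => lt; apply: hk; exists y; split=> //.
      exact: Rlt_le_trans hy (Rmin_l _ _).
    exact: Rlt_le_trans hy (Rmin_r _ _).
pose t k := vnorm (vsub (u k) xb).
have t0 k : 0 < t k.
  have := vnorm_ge0 (vsub (u k) xb); rewrite -/(t k) => ?.
  have [e|] := Req_dec (t k) 0; last lra.
  have := vnorm0_eq _ e => e'; have eu : u k = xb.
    by rewrite -(vadd_subK xb (u k)) e'; vring.
  have [_ _ _] := hu k; rewrite eu vsubvv vnorm_zero; lra.
have ct : cv t 0.
  apply: cv0_of_le cv_inv_succ => k; have [_ h _ _] := hu k.
  by rewrite Rabs_pos_eq; [exact: Rlt_le | exact: Rlt_le].
pose w k := vscale (/ t k) (vsub (u k) xb).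
have [|th [hth [w0 cw]]] := bounded_subseq w 1.
  move=> k; rewrite /w vnormZ Rabs_pos_eq; last by apply/Rlt_le/Rinv_0_lt_compat.
  by rewrite -/(t k) Rinv_l; [lra | have := t0 k; lra].
pose s k := t (th k).
have s0 k : 0 < s k := t0 _.
have cs : cv s 0 := cv_subseq th _ _ hth ct.
have ux k : vadd xb (vscale (s k) (w (th k))) = u (th k).
  by rewrite /w /s; have := t0 (th k) => ?; vfield; lra.
have c1 := cvD _ _ _ _ (g_taylor2 s _ _ s0 cs cw) (cv_dot _ _ _ _ (vcv_cst nu) (G_taylor2 s _ _ s0 cs cw)).
have [B hB] := cv_bounded _ _ c1.
have hle k : INR (th k) <= B.
  have [Gu _ hr hg] := hu (th k); rewrite -/(t (th k)) -/(s k) in hr hg.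
  have := proj1 hnu _ (proj1 (GamC _ hr) Gu) => nuG.
  have := hB k; rewrite ux (multiplier_dot nu) // dotZr dotBr dotZr.
  set a := dot nu (G _) in nuG *; set b := dot nu (mv A _).
  have sk := s0 k; have ss : 0 < s k * s k by nra.
  have -> : (g (u (th k)) - g xb - s k * - b) / (s k * s k) + / (s k * s k) * (a - s k * b)
     = (g (u (th k)) - g xb + a) / (s k * s k) by field; lra.
  have : (g (u (th k)) - g xb + a) / (s k * s k) <= - INR (th k).
    apply: (Rmult_le_reg_r (s k * s k)) => //.
    by rewrite /Rdiv Rmult_assoc Rinv_l; lra.
  split_Rabs; lra.
have th_ge k : (k <= th k)%nat by elim: k => // k IH; apply: leq_ltn_trans IH (hth k).
have [k hk] := INR_unbounded B.
have := hle k; have := le_INR _ _ (elimT leP (th_ge k)); lra.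
Qed.

Lemma norm_sq_shift (c x y : Vec n) : vnorm (vsub y c) * vnorm (vsub y c) =
  vnorm (vsub x c) * vnorm (vsub x c) - 2 * dot (vsub c x) (vsub y x)
    + vnorm (vsub y x) * vnorm (vsub y x).
Proof. by rewrite !vnorm_sq !dotBl !dotBr (dotC c x) (dotC y c) (dotC y x); ring. Qed.

(** A minimiser [x] of the penalised objective over the feasible points of a closed ball lies
    strictly inside the ball, so it is a local one. Expanding the penalty then shows that
    [rho (p - x)] is a regular subgradient of [f] at [x], the leftover [rho / 2 |y - x| ^ 2] being
    absorbed once [|y - x| < eps / rho]. *)
Lemma penalized_subgradient nu w : multiplier nu -> exists rho0, 0 < rho0 /\
  forall rho, rho0 <= rho -> exists N : nat, forall k : nat, (N <= k)%nat -> exists v,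
    vnorm v <= 3 * vnorm w /\
    reg_subdiff f (vadd xb (vscale (/ (INR k + 1)) v)) (vscale (/ (INR k + 1)) (vscale rho (vsub w v))).
Proof.
move=> /quadratic_lower_bound [c [r [c0 r0 hlow]]].
(* This gives [rho / 2 >= 4 * c], so that the quadratic loss of [g] is absorbed by half of the
   penalty in [h4] below. *)
exists (8 * c + 1); split; first lra.
move=> rho hrho.
have [N HN] := scaled_small (fun k => / (INR k + 1)) (fun _ => vscale 3 w) _ (r / 2) ltac:(lra)
  cv_inv_succ (vcv_cst _).
exists N => k /HN; rewrite vsub_addl !vnormZ; have := inv_succ_gt0 k.
move: (/ (INR k + 1)) => t t0; rewrite !Rabs_pos_eq; [|lra|lra] => small.
pose p := vadd xb (vscale t w).
pose S x := Gam x /\ vnorm (vsub x xb) <= r / 2.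
pose phi x := g x + rho / 2 * (vnorm (vsub x p) * vnorm (vsub x p)).
have [||||x [[Gx nx] hx]] := exists_min S phi (vnorm xb + r / 2).
- by exists xb; split=> //; rewrite vsubvv vnorm_zero; lra.
- move=> y [_ hy]; rewrite -(vadd_subK xb y); apply: Rle_trans (vnormD _ _) _; lra.
- move=> u y hu /[dup] /seq_convP uy cy; split; first by apply: Gamcl cy => j; case: (hu j).
  apply: cv_le (fun j => proj2 (hu j)) _ (cv_cst _).
  by apply: cv_norm; apply: vcvB => //; apply: vcv_cst.
- move=> u y _ _ uy; apply: cvD; first exact: frechet_s_cont uy.
  apply: cvM; first exact: cv_cst.
  by apply: cvM; apply: cv_norm; apply: vcvB => //; apply: vcv_cst.
exists (vscale (/ t) (vsub x xb)).
have tK (y : Vec n) : vscale t (vscale (/ t) y) = y by vfield; lra.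
have w0 := vnorm_ge0 w.
(* Comparing [x] with the competitor [xb] yields [d ^ 2 <= 8 (t |w|) ^ 2]; 3 is a convenient bound
   for the square root of 8. *)
have nv : vnorm (vsub x xb) <= 3 * (t * vnorm w).
  have lowx := hlow x Gx ltac:(lra).
  have Sxb : S xb by split=> //; rewrite vsubvv vnorm_zero; lra.
  have := hx xb Sxb; rewrite /phi.
  have e : vnorm (vsub xb p) = t * vnorm w.
    by rewrite vnorm_subC vsub_addl vnormZ Rabs_pos_eq //; lra.
  rewrite e.
  have := vnorm_tri p x xb; rewrite (vnorm_subC p) e.
  have := vnorm_ge0 (vsub x p); have := vnorm_ge0 (vsub x xb).
  move: (vnorm (vsub x xb)) (vnorm (vsub x p)) lowx => d b lowx d0 b0 tri hmin.
  have tw : 0 <= t * vnorm w by nra.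
  move: (t * vnorm w) tw tri hmin => e' e0 tri hmin.
  have h1 : rho * (b * b) <= 2 * c * (d * d) + rho * (e' * e') by nra.
  have h2 : d * d <= 2 * (b * b) + 2 * (e' * e').
    have := Rmult_le_compat _ _ _ _ d0 d0 tri tri; have := Rle_0_sqr (b - e'); rewrite /Rsqr; lra.
  have h3 : rho * (d * d) <= 4 * c * (d * d) + 4 * rho * (e' * e').
    have := Rmult_le_compat_l rho _ _ ltac:(lra) h2; lra.
  have h4 : d * d <= 8 * (e' * e').
    apply: (Rmult_le_reg_l (rho / 2)); first lra.
    have : 0 <= (rho / 2 - 4 * c) * (d * d) by apply: Rmult_le_pos; nra.
    lra.
  nra.
split.
  rewrite vnormZ Rabs_pos_eq; last by apply/Rlt_le/Rinv_0_lt_compat.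
  apply: (Rmult_le_reg_l t) => //.
  by rewrite -Rmult_assoc Rinv_r; lra.
have -> : vscale t (vscale rho (vsub w (vscale (/ t) (vsub x xb)))) = vscale rho (vsub p x).
  by rewrite /p; vfield; lra.
rewrite tK vadd_subK.
exists (g x); split; first by apply/fE.
move=> eps e0.
have nx' : vnorm (vsub x xb) < r / 2 by lra.
exists (Rmin (r / 2 - vnorm (vsub x xb)) (eps / rho)); split.
  by apply: Rmin_pos; [lra | apply: Rdiv_lt_0_compat; lra].
move=> y fy hy /fE [Gy ->].
have hy1 := Rlt_le_trans _ _ _ hy (Rmin_l _ _); have hy2 := Rlt_le_trans _ _ _ hy (Rmin_r _ _).
have := hx y; rewrite /phi (norm_sq_shift p x y) dotZl.
have Sy : S y by split=> //; have := vnorm_tri x y xb; lra.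
move=> /(_ Sy) H1; have := vnorm_ge0 (vsub y x) => ny.
have : rho * vnorm (vsub y x) <= eps.
  have := Rmult_le_compat_l rho _ _ ltac:(lra) (Rlt_le _ _ hy2).
  by have -> : rho * (eps / rho) = eps by field; lra.
nra.
Qed.

Lemma penalized_graph_deriv nu w : multiplier nu -> exists rho0, 0 < rho0 /\
  forall rho, rho0 <= rho -> exists v, vnorm v <= 3 * vnorm w /\
    tcone2 (lim_subdiff f) xb vzero v (vscale rho (vsub w v)).
Proof.
move=> hnu; have [rho0 [p0 h]] := penalized_subgradient nu w hnu.
exists rho0; split=> // rho /h [N HN].
have [v hv] := choose_seq _ (fun k => HN (k + N)%nat (leq_addl _ _)).
have [th [hth [v0 cv0]]] := bounded_subseq v _ (fun k => proj1 (hv k)).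
exists v0; split.
  exact: cv_le (fun k => proj1 (hv (th k))) (cv_norm _ _ cv0) (cv_cst _).
exists (fun k => / (INR (th k + N)%nat + 1)), (fun k => v (th k)),
  (fun k => vscale rho (vsub w (v (th k)))).
split; first by move=> k; apply: inv_succ_gt0.
split; first by apply/is_lim_seq_Reals; exact: (cv_subseq th _ _ hth (cv_shift _ _ N cv_inv_succ)).
split; first exact/seq_convP.
split; first by apply/seq_convP; apply: vcvZ; [apply: cv_cst | apply: vcvB => //; apply: vcv_cst].
move=> k; apply: lim_subdiff_of_reg.
rewrite (_ : vadd vzero _ = vscale (/ (INR (th k + N)%nat + 1)) (vscale rho (vsub w (v (th k))))).
  exact: (proj2 (hv (th k))).
vring.
Qed.

Lemma hessM_bound B : 0 <= B -> exists K, forall mu u, vnorm mu <= B -> vnorm u <= B ->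
  vnorm (mv (hessM mu) u) <= K.
Proof.
move=> B0.
exists (vsum (fun a => vsum (fun b => Rabs (H a b) + B * vsum (fun i => Rabs (D2G i a b)))) * B) => mu u hmu hu.
apply: Rle_trans (mv_bound _ _) _; apply: Rmult_le_compat => //.
- by do 2![apply: vsum_ge0 => ?]; apply: Rabs_pos.
- exact: vnorm_ge0.
do 2![apply: vsum_le => ?]; apply: Rle_trans (Rabs_triang _ _) _; apply: Rplus_le_compat_l.
apply: Rle_trans (vsum_abs _) _; rewrite -vsumZ; apply: vsum_le => i; rewrite Rabs_mult.
apply: Rmult_le_compat_r; first exact: Rabs_pos.
exact: Rle_trans (vnorm_coord _ _) hmu.
Qed.

Lemma critical_dom nu w : multiplier nu -> critical w ->
  exists z, tcone2 (lim_subdiff f) xb vzero w z.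
Proof.
move=> hnu hw; have [rho0 [p0 h]] := penalized_graph_deriv nu w hnu.
(* The penalty tends to infinity and is at least [INR k + 1], so a bound [K] on [rho (w - v)] gives
   [|v - w| <= K / (INR k + 1)]. *)
pose rho k := rho0 + 1 + INR k.
have rhok k : rho0 <= rho k by have := pos_INR k; rewrite /rho; lra.
have [v hv] := choose_seq _ (fun k => h (rho k) (rhok k)).
(* One constant bounding both the limit multipliers and the directions [v k], whatever the
   penalty. *)
pose B := kap * vnorm (Dg xb) + 3 * vnorm w.
have n1 := vnorm_ge0 (Dg xb); have n2 := vnorm_ge0 w.
have [|K hK] := hessM_bound B; first by rewrite /B; nra.
have zK k : vnorm (vscale (rho k) (vsub w (v k))) <= K.
  have [nv /exists_multiplier_seq [mu [t [wk [zk [muk [ms nmu]]]]]]] := hv k.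
  have h1 := eta_normal _ _ _ _ _ _ _ ms w hw; have h2 := eta_dot0 _ _ _ _ _ _ _ ms.
  apply: Rle_trans (hK mu (v k) _ _); try by rewrite /B; nra.
  set z := vscale _ _ in h1 h2 *; set ze := mv _ _ in h1 h2 *.
  (* The vector [z - ze] is orthogonal to [v k] and nonpositive on the critical [w], hence
     nonpositive on [z = rho (w - v k)]. So [|z| ^ 2 <= <ze, z>] and [|z| <= |ze| <= K]. *)
  have hz : dot (vsub z ze) z <= 0.
    rewrite {2}/z dotZr dotBr; have := pos_INR k; rewrite /rho; nra.
  have := dot_le_norm ze z; move: hz; rewrite dotBl -vnorm_sq.
  have := vnorm_ge0 z; have := vnorm_ge0 ze; nra.
have [th [hth [z cz]]] := bounded_subseq _ _ zK.
exists z; apply: (tcone2_closed _ _ _ _ _ _ _ (fun k => proj2 (hv (th k)))) cz.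
apply: (vcv_subseq th _ _ hth).
apply: (vcv_of_le _ _ (fun k => K * / (INR k + 1))); last first.
  by have := cvM _ _ _ _ (cv_cst K) cv_inv_succ; rewrite Rmult_0_r.
move=> k; have := zK k; have := pos_INR k => k0.
rewrite vnormZ Rabs_pos_eq; last by rewrite /rho; lra.
rewrite vnorm_subC => hk; apply: (Rmult_le_reg_l (INR k + 1)); first lra.
rewrite Rmult_comm -[X in _ <= X]Rmult_comm Rmult_assoc Rinv_l; last lra.
have := vnorm_ge0 (vsub (v k) w); rewrite /rho in hk; nra.
Qed.

End SecondOrder.

(** * Local openness of a submersion *)

(** Meeting [P] once per convergent sequence is enough: if every radius failed, the bad points would
    form a convergent sequence avoiding [P]. *)
Lemma eventually_near {n} (P : Vec n -> Prop) x :
  (forall u, vcv u x -> exists k : nat, P (u k)) ->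
  exists r, 0 < r /\ forall y, vnorm (vsub y x) < r -> P y.
Proof.
move=> h; apply: NNPP => hn.
have [u hu] : exists u, forall k, vnorm (vsub (u k) x) < / (INR k + 1) /\ ~ P (u k).
  apply: (choose_seq (fun k u => vnorm (vsub u x) < / (INR k + 1) /\ ~ P u)) => k.
  apply: NNPP => hk; apply: hn; exists (/ (INR k + 1)); split; first exact: inv_succ_gt0.
  by move=> y hy; apply: NNPP => hP; apply: hk; exists y.
have [|k Pk] := h u; last by case: (hu k).
by apply: vcv_of_le cv_inv_succ => k; apply: Rlt_le; case: (hu k).
Qed.

Lemma exists_right_inverse {m l} (A : Mat l m) : (forall v, exists u, mv A u = v) ->
  exists B : Mat m l, forall v, mv A (mv B v) = v.
Proof.
move=> h.
pose u j := sval (constructive_indefinite_description _ (h (fun i => if i == j then 1 else 0))).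
have hu j : mv A (u j) = fun i => if i == j then 1 else 0.
  by rewrite /u; case: constructive_indefinite_description.
exists (fun i j => u j i) => v; apply: functional_extensionality => i.
rewrite /mv; under vsum_ext do rewrite -vsumZ.
rewrite vsum_exchange -[RHS](vsum_delta v i); apply: vsum_ext => j.
rewrite eq_sym -[if _ then _ else _](congr1 (fun f => f i) (hu j)) /mv -vsumZ.
by apply: vsum_ext => a; ring.
Qed.

Section Surjection.

Variables (m l : nat) (h : Vec m -> Vec l) (Dh : Vec m -> Mat l m) (D : 'I_l -> Mat m m).
Variables (V : Vec m -> Prop) (yb : Vec m) (B : Mat m l).
Hypothesis HVo : is_open V.
Hypothesis HVy : V yb.
Hypothesis Hh1 : forall y, V y -> frechet h y (Dh y).
Hypothesis Hh2 : forall k, frechet (fun z => Dh z k) yb (D k).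
Hypothesis HB : forall v, mv (Dh yb) (mv B v) = v.

(** The summand 1 keeps [K] positive even for [B = 0], since [K] occurs in denominators. *)
Let K := vsum (fun i => vsum (fun j => Rabs (B i j))) + 1.

Let K0 : 0 < K.
Proof.
suff : 0 <= vsum (fun i => vsum (fun j => Rabs (B i j))) by rewrite /K; lra.
by do 2![apply: vsum_ge0 => ?]; apply: Rabs_pos.
Qed.

Let BK v : vnorm (mv B v) <= K * vnorm v.
Proof. by apply: Rle_trans (mv_bound _ _) _; rewrite /K; have := vnorm_ge0 v; nra. Qed.

Lemma right_inverse_near : exists r, 0 < r /\ forall y, vnorm (vsub y yb) < r ->
  V y /\ forall v, vnorm (vsub (mv (Dh y) (mv B v)) v) <= / 2 * vnorm v.
Proof.
apply: (eventually_near (fun y => V y /\ forall v, vnorm (vsub (mv (Dh y) (mv B v)) v) <= / 2 * vnorm v)) => u cu.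
have [d [d0 hd]] := HVo yb HVy.
have /seq_convP cu' := cu; have [N1 H1] := cu' _ d0.
pose S y := vsum (fun i => vsum (fun j => Rabs (Dh y i j - Dh yb i j))).
have cS : cv (fun k => S (u k)) 0.
  have -> : 0 = S yb.
    by rewrite /S /vsum big1 // => i _; rewrite big1 // => j _; rewrite Rminus_diag Rabs_R0.
  apply: cv_sum => i; apply: cv_sum => j.
  apply: (is_lim_seq_abs _ (Finite _)); apply: cvB; last exact: cv_cst.
  exact: (frechet_cont _ _ _ _ (Hh2 i) cu j).
have [N2 H2] := cv_eventually_lt _ _ (/ (2 * K)) cS ltac:(apply: Rinv_0_lt_compat; lra).
exists (maxn N1 N2); split; first by apply: hd; apply: H1; rewrite leq_maxl.
move=> v; set y := u _.
rewrite -{2}(HB v).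
have -> : vsub (mv (Dh y) (mv B v)) (mv (Dh yb) (mv B v)) = mv (fun i j => Dh y i j - Dh yb i j) (mv B v).
  move: (mv B v) => b; apply: functional_extensionality => i; rewrite /vsub /mv /Rminus.
  rewrite (_ : - vsum _ = -1 * vsum (fun j => Dh yb i j * b j)); last by ring.
  by rewrite -vsumZ -vsumD; apply: vsum_ext => j; ring.
apply: Rle_trans (mv_bound _ _) _; rewrite -/(S y).
have Sy : S y < / (2 * K) by apply: H2; rewrite leq_maxr.
have S0 : 0 <= S y by do 2![apply: vsum_ge0 => ?]; apply: Rabs_pos.
apply: (Rle_trans _ (/ (2 * K) * (K * vnorm v))).
  by apply: Rmult_le_compat; [|exact: vnorm_ge0|lra|].
by apply: Req_le; field; lra.
Qed.

(* Ekeland-type argument: a minimiser of [|h y - c| + |y - y0| / (4 K)] solves [h y = c], since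
   otherwise the direction [B (c - h y)] would decrease the objective. *)
Lemma local_surjection : exists L r, [/\ 0 < L, 0 < r & forall y0 c,
  vnorm (vsub y0 yb) < r -> vnorm (vsub (h y0) c) < r ->
  exists y, [/\ V y, h y = c & vnorm (vsub y y0) <= L * vnorm (vsub (h y0) c)]].
Proof.
have [d [d0 hd]] := right_inverse_near.
(* The ball of radius [d / 4] around [y0] must stay within [d] of [yb]. The second radius gives
   [4 * K * e < d / 4], so that the minimiser is interior to that ball. *)
exists (4 * K), (Rmin (d / 2) (d / (16 * K))); split; first lra.
  by apply: Rmin_pos; apply: Rdiv_lt_0_compat; lra.
move=> y0 c hy hc.
have {}hy := Rlt_le_trans _ _ _ hy (Rmin_l _ _); have {}hc := Rlt_le_trans _ _ _ hc (Rmin_r _ _).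
set e := vnorm (vsub (h y0) c) in hc *.
have e0 : 0 <= e := vnorm_ge0 _.
have he : 4 * K * e < d / 4.
  have := Rmult_lt_compat_l (4 * K) _ _ ltac:(lra) hc.
  by have -> : 4 * K * (d / (16 * K)) = d / 4 by field; lra.
pose sg := / (4 * K).
have sg0 : 0 < sg by apply: Rinv_0_lt_compat; lra.
have sgK : sg * K = / 4 by rewrite /sg; field; lra.
pose S y := vnorm (vsub y y0) <= d / 4.
have Sd y : S y -> vnorm (vsub y yb) < d by rewrite /S => ?; have := vnorm_tri y0 y yb; lra.
pose F y := vnorm (vsub (h y) c) + sg * vnorm (vsub y y0).
have [||||y [Sy hmin]] := exists_min S F (vnorm y0 + d / 4).
- by exists y0; rewrite /S vsubvv vnorm_zero; lra.
- move=> y Sy; rewrite -(vadd_subK y0 y); apply: Rle_trans (vnormD _ _) _; rewrite /S in Sy; lra.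
- move=> u y hu /seq_convP uy; apply: cv_le hu _ (cv_cst _).
  by apply: cv_norm; apply: vcvB => //; apply: vcv_cst.
- move=> u y _ Sy uy; apply: cvD.
    apply: cv_norm; apply: vcvB; last exact: vcv_cst.
    by apply: frechet_cont uy; apply: Hh1; apply: (proj1 (hd _ (Sd _ Sy))).
  apply: cvM; first exact: cv_cst.
  by apply: cv_norm; apply: vcvB => //; apply: vcv_cst.
have [Vy hDy] := hd _ (Sd _ Sy).
have Fy : F y <= e.
  have := hmin y0; rewrite {2}/F vsubvv vnorm_zero -/e Rmult_0_r Rplus_0_r; apply.
  by rewrite /S vsubvv vnorm_zero; lra.
have ny : vnorm (vsub y y0) <= 4 * K * e.
  apply: (Rmult_le_reg_l sg) => //.
  have -> : sg * (4 * K * e) = e by rewrite /sg; field; lra.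
  have := vnorm_ge0 (vsub (h y) c); rewrite /F in Fy; lra.
exists y; split=> //.
pose a := vsub c (h y).
have a0 := vnorm_ge0 a.
have [ea|na] := Req_dec (vnorm a) 0.
  rewrite -(vadd_subK (h y) c) -/a (vnorm0_eq _ ea); vring.
exfalso.
have [del [del0 hdel]] := Hh1 y Vy (/ (8 * K)) ltac:(apply: Rinv_0_lt_compat; lra).
pose v := mv B a.
have nv : vnorm v <= K * vnorm a := BK a.
have v0 := vnorm_ge0 v.
pose mm := Rmin del (d / 4 - vnorm (vsub y y0)).
have mm0 : 0 < mm by apply: Rmin_pos; lra.
pose t := Rmin 1 (mm / (2 * (vnorm v + 1))).
have t0 : 0 < t by apply: Rmin_pos; [lra | apply: Rdiv_lt_0_compat; lra].
have t1 : t <= 1 := Rmin_l _ _.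
have tv : t * vnorm v < mm.
  have h1 : t <= mm / (2 * (vnorm v + 1)) := Rmin_r _ _.
  have h2 : mm / (2 * (vnorm v + 1)) * (2 * (vnorm v + 1)) = mm by field; lra.
  nra.
have tv1 : t * vnorm v < del := Rlt_le_trans _ _ _ tv (Rmin_l _ _).
have tv2 : t * vnorm v < d / 4 - vnorm (vsub y y0) := Rlt_le_trans _ _ _ tv (Rmin_r _ _).
pose y' := vadd y (vscale t v).
have ntv : vnorm (vsub y' y) = t * vnorm v by rewrite vsub_addl vnormZ Rabs_pos_eq //; lra.
have ny' : vnorm (vsub y' y0) <= vnorm (vsub y y0) + t * vnorm v.
  by have := vnorm_tri y y' y0; lra.
have Sy' : S y' by rewrite /S; lra.
have := hmin _ Sy'; rewrite /F.
have := hdel y'; rewrite ntv => /(_ tv1) h1.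
have h2 := hDy a; rewrite -/v in h2.
(* Balance in units of [t |a|]: the approximate Newton step gains 1/2, the linearisation error costs
   1/8 and the distance term 1/4, a net decrease of 1/8. *)
have h3 : vnorm (vsub (h y') c) <= / (8 * K) * (t * vnorm v) + (t * (/ 2 * vnorm a) + (1 - t) * vnorm a).
  have -> : vsub (h y') c = vadd (vsub (vsub (h y') (h y)) (mv (Dh y) (vsub y' y)))
     (vadd (vscale t (vsub (mv (Dh y) v) a)) (vscale (-(1 - t)) a)).
    by rewrite vsub_addl mvZ /a; vring.
  apply: Rle_trans (vnormD _ _) _; apply: Rplus_le_compat => //.
  apply: Rle_trans (vnormD _ _) _; rewrite !vnormZ Rabs_Ropp !Rabs_pos_eq; try lra.
  nra.
have h4 : / (8 * K) * (t * vnorm v) <= t * vnorm a / 8.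
  have -> : t * vnorm a / 8 = / (8 * K) * (t * (K * vnorm a)) by field; lra.
  apply: Rmult_le_compat_l; first by apply/Rlt_le/Rinv_0_lt_compat; lra.
  nra.
have h5 : sg * vnorm (vsub y' y0) <= sg * vnorm (vsub y y0) + t * vnorm a / 4.
  have : sg * (t * vnorm v) <= sg * (t * (K * vnorm a)).
    by apply: Rmult_le_compat_l; [lra | nra].
  have -> : sg * (t * (K * vnorm a)) = sg * K * (t * vnorm a) by ring.
  rewrite sgK; nra.
rewrite (vnorm_subC (h y)) -/a.
have : 0 < t * vnorm a by nra.
lra.
Qed.

End Surjection.

(** * Reduction to the cone C *)

Section ConeReduction.

Variables (m l : nat) (h : Vec m -> Vec l) (Dh : Vec m -> Mat l m) (D : 'I_l -> Mat m m).
Variables (Theta V : Vec m -> Prop) (C : Vec l -> Prop) (yb : Vec m).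
Hypothesis HTcv : is_convex Theta.
Hypothesis HTy : Theta yb.
Hypothesis HVo : is_open V.
Hypothesis HVy : V yb.
Hypothesis Hh1 : forall y, V y -> frechet h y (Dh y).
Hypothesis Hh2 : forall k, frechet (fun z => Dh z k) yb (D k).
Hypothesis Hh0 : h yb = vzero.
Hypothesis Hsurj : forall v : Vec l, exists u : Vec m, mv (Dh yb) u = v.
Hypothesis Hred : forall y, V y -> (Theta y <-> C (h y)).
Hypothesis HCcone : is_cone C.

Lemma h_quotient u : vcv (fun k => vscale (/ / (INR k + 1)) (h (vadd yb (vscale (/ (INR k + 1)) u))))
  (mv (Dh yb) u).
Proof.
move=> i.
have tn k : / (INR k + 1) <> 0 by have := inv_succ_gt0 k; lra.
apply: cv_ext (frechet_hder _ _ _ i (Hh1 _ HVy) _ (fun _ => u) u tn cv_inv_succ (vcv_cst u)) _ _ => // k.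
by rewrite Hh0 /vscale /vzero /Rdiv Rminus_0_r Rmult_comm.
Qed.

(** By convexity the segment from [yb] to [y] lies in [Theta]; its initial part is mapped by [h]
    into [C], and the quotients of [h] converge to [Dh u]. *)
Lemma normal_of_polar mu : (forall c, C c -> dot mu c <= 0) ->
  normal_cone_convex Theta yb (mtv (Dh yb) mu).
Proof.
move=> hmu y Ty; rewrite dot_mtv; set u := vsub y yb.
have [d [d0 hd]] := HVo yb HVy.
have /seq_convP /(_ d d0) [N HN] := vcv_vadd_vscale yb _ _ _ cv_inv_succ (vcv_cst u).
apply: cv_le _ (cv_shift _ _ N (cv_dot _ _ _ _ (vcv_cst mu) (h_quotient u))) (cv_cst 0) => k.
have /hd Vk := HN _ (leq_addl k N).
move: (k + N)%nat Vk => j; have := inv_succ_gt0 j.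
have : / (INR j + 1) <= 1.
  by rewrite -[X in _ <= X]Rinv_1; apply: Rinv_le_contravar; have := pos_INR j; lra.
move: (/ (INR j + 1)) => t t1 t0 Vk.
have Ck : C (h (vadd yb (vscale t u))).
  apply/Hred => //; have := HTcv _ _ t Ty HTy ltac:(lra).
  by rewrite (_ : vadd (vscale t y) _ = vadd yb (vscale t u)) // /u; vring.
rewrite dotZr; have := hmu _ Ck; have := Rinv_0_lt_compat _ t0; nra.
Qed.

(** Such a [u] is tangent to [Theta]: local surjectivity corrects [yb + t u] to a solution of
    [h y = t Dh u], hence a point of [Theta], at a distance that is [o(t)]. *)
Lemma normal_tangent lam u : normal_cone_convex Theta yb lam -> C (mv (Dh yb) u) -> dot lam u <= 0.
Proof.
move=> hlam Cu.
have [B HB] := exists_right_inverse (Dh yb) Hsurj.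
have [L [r [L0 r0 hL]]] := local_surjection _ _ h Dh D V yb B HVo HVy Hh1 Hh2 HB.
pose e k := vnorm (vsub (vscale (/ / (INR k + 1)) (h (vadd yb (vscale (/ (INR k + 1)) u)))) (mv (Dh yb) u)).
have ce : cv e 0.
  have := cv_norm _ _ (vcvB _ _ _ _ (h_quotient u) (vcv_cst (mv (Dh yb) u))).
  by rewrite vsubvv vnorm_zero.
have /seq_convP /(_ r r0) [N1 HN1] := vcv_vadd_vscale yb _ _ _ cv_inv_succ (vcv_cst u).
have [N2 HN2] := cv_eventually_lt _ _ r (cvM _ _ _ _ cv_inv_succ ce) ltac:(lra).
pose N := maxn N1 N2.
have cle : cv (fun k => vnorm lam * L * e (k + N)%nat) 0.
  by have := cvM _ _ _ _ (cv_cst (vnorm lam * L)) (cv_shift _ _ N ce); rewrite Rmult_0_r.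
apply: cv_le _ (cv_cst (dot lam u)) cle => k.
have := leq_addl k N; rewrite geq_max => /andP [/HN1 k1 /HN2].
move: (k + N)%nat k1 => j; rewrite /e; have := inv_succ_gt0 j.
move: (/ (INR j + 1)) => t t0 k1.
set E := vnorm _.
have E_eq : vnorm (vsub (h (vadd yb (vscale t u))) (vscale t (mv (Dh yb) u))) = t * E.
  have -> : vsub (h (vadd yb (vscale t u))) (vscale t (mv (Dh yb) u)) =
    vscale t (vsub (vscale (/ t) (h (vadd yb (vscale t u)))) (mv (Dh yb) u)) by vfield; lra.
  by rewrite vnormZ Rabs_pos_eq //; lra.
move=> k2.
have [|y [Vy hy ny]] := hL (vadd yb (vscale t u)) (vscale t (mv (Dh yb) u)) k1.
  by rewrite E_eq.
have Ty : Theta y by apply/Hred => //; rewrite hy; apply: HCcone => //; lra.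
have h1 := hlam y Ty.
have h2 := dot_le_norm lam (vsub (vadd yb (vscale t u)) y).
rewrite vnorm_subC in h2; rewrite E_eq in ny.
have h3 : t * dot lam u <= vnorm lam * (L * (t * E)).
  move: h1 h2; rewrite !dotBr dotDr dotZr => h1 h2.
  have := Rmult_le_compat_l _ _ _ (vnorm_ge0 lam) ny; lra.
apply: (Rmult_le_reg_l t) => //; lra.
Qed.

(** A kernel vector of [Dh yb] and its opposite are both sent to 0, which is in [C], so [lam]
    vanishes on the kernel and factors through [Dh yb]; a right inverse [B] exhibits the factor. *)
Lemma polar_of_normal lam : normal_cone_convex Theta yb lam ->
  exists mu, (forall c, C c -> dot mu c <= 0) /\ mtv (Dh yb) mu = lam.
Proof.
move=> hlam; have [B HB] := exists_right_inverse (Dh yb) Hsurj.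
have C0 : C vzero by rewrite -Hh0; apply/Hred.
exists (mtv B lam); split=> [c Cc|].
  by rewrite dot_mtv; apply: normal_tangent; rewrite ?HB.
apply: dot_ext => u; rewrite !dot_mtv.
have k0 : mv (Dh yb) (vsub u (mv B (mv (Dh yb) u))) = vzero by rewrite mvB HB vsubvv.
have := normal_tangent lam (vsub u (mv B (mv (Dh yb) u))) hlam.
have := normal_tangent lam (vscale (-1) (vsub u (mv B (mv (Dh yb) u)))) hlam.
rewrite mvZ k0 (_ : vscale (-1) vzero = vzero); last by vring.
move=> /(_ C0) h1 /(_ C0) h2; move: h1 h2; rewrite dotZr dotBr; lra.
Qed.

(** Surjectivity of [Dh yb] makes its transpose injective, so the choice operator has only one
    possible value. *)
Lemma mu_of_mtv mu : mu_of Dh yb (mtv (Dh yb) mu) = mu.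
Proof.
have := epsilon_spec (inhabits (fun _ => 0)) (fun nu : Vec l => mtv (Dh yb) nu = mtv (Dh yb) mu)
  (ex_intro _ mu erefl).
rewrite -/(mu_of Dh yb (mtv (Dh yb) mu)) => e; apply: dot_ext => v.
by have [u <-] := Hsurj v; rewrite -!dot_mtv e.
Qed.

End ConeReduction.

(** * First and second derivatives of the composite [h \o q] *)

Section Composite.

Variables (n m l : nat) (q : Vec n -> Vec m) (Dq : Vec n -> Mat m n) (D2q : 'I_m -> Mat n n).
Variables (h : Vec m -> Vec l) (Dh : Vec m -> Mat l m) (D2h : 'I_l -> Mat m m) (xb : Vec n).

Definition comp_jac (x : Vec n) : Mat l n := fun i => mtv (Dq x) (Dh (q x) i).
(** Written in the shape produced by [hder_sum] and [hder_mul] for the entries of [comp_jac], so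
    that differentiation needs no rewriting; [qform_comp_hess] gives the usual form. *)
Definition comp_hess (i : 'I_l) : Mat n n := fun a b => vsum (fun j =>
  vadd (vscale (Dh (q xb) i j) (D2q j a)) (vscale (Dq xb j a) (mtv (Dq xb) (D2h i j))) b).

Lemma comp_jac_hder x i : frechet q x (Dq x) -> frechet h (q x) (Dh (q x)) ->
  hder (fun y => h (q y) i) x (comp_jac x i).
Proof.
move=> hq hh; apply: (hder_comp (fun y => h y i)); last exact: (frechet_hder h).
by move=> j; apply: (frechet_hder q).
Qed.

Lemma comp_hess_hder i a : frechet q xb (Dq xb) ->
  (forall j, frechet (fun z => Dq z j) xb (D2q j)) ->
  frechet (fun z => Dh z i) (q xb) (D2h i) ->
  hder (fun x => comp_jac x i a) xb (comp_hess i a).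
Proof.
move=> hq hq2 hh; apply: (hder_sum (fun j x => Dq x j a * Dh (q x) i j)) => j.
apply: hder_mul; first exact: (frechet_hder (fun z => Dq z j)).
apply: (hder_comp (fun y => Dh y i j)); last exact: (frechet_hder (fun z => Dh z i)).
by move=> k; apply: (frechet_hder q).
Qed.

Lemma mv_comp_jac w : mv (comp_jac xb) w = mv (Dh (q xb)) (mv (Dq xb) w).
Proof. by apply: functional_extensionality => i; apply: dot_mtv. Qed.

Lemma mtv_comp_jac mu : mtv (comp_jac xb) mu = mtv (Dq xb) (mtv (Dh (q xb)) mu).
Proof. by apply: dot_ext => u; rewrite !dot_mtv mv_comp_jac. Qed.

Lemma qform_comp_hess i w : qform (comp_hess i) w =
  mv (Dh (q xb)) (fun j => qform (D2q j) w) i + qform (D2h i) (mv (Dq xb) w).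
Proof.
have e a : mv (comp_hess i) w a =
    vsum (fun j => Dh (q xb) i j * mv (D2q j) w a + Dq xb j a * mv (D2h i) (mv (Dq xb) w) j).
  rewrite /mv -/(mv (Dq xb) w) /comp_hess; under vsum_ext do rewrite Rmult_comm -vsumZ.
  rewrite vsum_exchange; apply: vsum_ext => j.
  have -> : vsum (fun b => D2h i j b * mv (Dq xb) w b) = dot (mtv (Dq xb) (D2h i j)) w.
    by rewrite dot_mtv.
  rewrite /dot -!vsumZ -vsumD; apply: vsum_ext => b; rewrite /vadd /vscale; ring.
rewrite /qform {1}/dot; under vsum_ext do rewrite e -vsumZ.
rewrite vsum_exchange.
rewrite -[mv (Dh _) _ i]/(vsum (fun j => Dh (q xb) i j * vsum (fun a => w a * mv (D2q j) w a))).
rewrite /dot -vsumD; apply: vsum_ext => j.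
move: (mv (D2h i) (mv (Dq xb) w) j) => y.
have -> : mv (Dq xb) w j * y = vsum (fun a => y * (Dq xb j a * w a)) by rewrite vsumZ Rmult_comm.
rewrite -vsumZ -vsumD; apply: vsum_ext => a; ring.
Qed.

(** [hessL] is by conversion the [hessM] of the constraint map [q], so both sides expand by the same
    lemma. The curvature of [q] paired with [Dh^T mu] and the form [Htilde_form] are the two halves
    of [qform_comp_hess] paired with [mu]. *)
Lemma soc_value_reduced (D2g : Vec n -> Mat n n) (D2q' : Vec n -> 'I_m -> Mat n n)
    (D2h' : Vec m -> 'I_l -> Mat m m) mu w :
  (forall v : Vec l, exists u : Vec m, mv (Dh (q xb)) u = v) ->
  D2q' xb = D2q -> D2h' (q xb) = D2h ->
  soc_value D2g q Dq D2q' Dh D2h' xb (mtv (Dh (q xb)) mu) w =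
  qform (hessM n l (D2g xb) comp_hess mu) w.
Proof.
move=> hs eq eh; rewrite /soc_value /Htilde_form mu_of_mtv // eh qform_lincomb.
rewrite qform_hessM -[hessL _ _ _ _]/(hessM n m (D2g xb) (D2q' xb) _) qform_hessM eq Rplus_assoc.
congr Rplus; rewrite dot_mtv -dotDr; congr dot.
by apply: functional_extensionality => i; rewrite qform_comp_hess.
Qed.

End Composite.

Lemma fobjP {n m} (g : Vec n -> R) (q : Vec n -> Vec m) (Theta : Vec m -> Prop) y a :
  fobj g q Theta y = Some a <-> Gamma q Theta y /\ a = g y.
Proof.
rewrite /fobj; case: excluded_middle_informative => hG; split=> //.
- by case=> ->.
- by case=> _ ->.
- by case.
Qed.

Lemma frechet_near {n m} (F : Vec n -> Vec m) x J eps : frechet F x J -> 0 < eps ->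
  exists r, 0 < r /\ forall y, vnorm (vsub y x) < r -> vnorm (vsub (F y) (F x)) < eps.
Proof.
move=> hF e0; apply: (eventually_near (fun y => vnorm (vsub (F y) (F x)) < eps)) => u cu.
have /seq_convP /(_ _ e0) [N HN] := frechet_cont _ _ _ _ hF cu.
by exists N; apply: HN.
Qed.

Theorem theorem4p5
  (n m l : nat)
  (g : Vec n -> R) (Dg : Vec n -> Vec n) (D2g : Vec n -> Mat n n)
  (q : Vec n -> Vec m) (Dq : Vec n -> Mat m n) (D2q : Vec n -> 'I_m -> Mat n n)
  (Theta : Vec m -> Prop) (C : Vec l -> Prop) (V : Vec m -> Prop)
  (h : Vec m -> Vec l) (Dh : Vec m -> Mat l m) (D2h : Vec m -> 'I_l -> Mat m m)
  (xb : Vec n)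
  (* g is C^2 with gradient Dg and Hessian D2g *)
  (Hg1 : forall x, frechet_s g x (Dg x))
  (Hg2 : forall x, frechet Dg x (D2g x))
  (Hg3 : forall x, mat_cont_at D2g x)
  (* q is C^2 with Jacobian Dq and component Hessians D2q *)
  (Hq1 : forall x, frechet q x (Dq x))
  (Hq2 : forall x i, frechet (fun z => Dq z i) x (D2q x i))
  (Hq3 : forall x i, mat_cont_at (fun z => D2q z i) x)
  (* Theta nonempty closed convex *)
  (HTne : exists y, Theta y) (HTcl : is_closed Theta) (HTcv : is_convex Theta)
  (* xb feasible *)
  (Hxb : Gamma q Theta xb)
  (* C^2-cone reducibility of Theta at yb = q xb to the pointed closed convex cone C *)
  (HVo : is_open V) (HVy : V (q xb))
  (Hh1 : forall y, V y -> frechet h y (Dh y))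
  (Hh2 : forall y k, V y -> frechet (fun z => Dh z k) y (D2h y k))
  (Hh3 : forall y k, V y -> mat_cont_at (fun z => D2h z k) y)
  (Hh0 : h (q xb) = vzero)
  (Hsurj : forall v : Vec l, exists u : Vec m, mv (Dh (q xb)) u = v)
  (Hred : forall y, V y -> (Theta y <-> C (h y)))
  (HCcl : is_closed C) (HCcv : is_convex C) (HCcone : is_cone C) (HCpt : is_pointed C)
  (* MSCQ at xb *)
  (HMSCQ : exists kappa, 0 < kappa /\ exists del, 0 < del /\ forall x,
      vnorm (vsub x xb) < del ->
      dist_set x (Gamma q Theta) <= kappa * dist_set (q x) Theta)
  (* xb stationary *)
  (Hstat : exists lam, Lambda Dg q Dq Theta xb lam) :
  let f := fobj g q Theta in
  let P1 := local_min_P g q Theta xb in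
  let P2 := forall w z, dom_graph_deriv_subdiff f xb vzero w ->
              graph_deriv_subdiff f xb vzero w z -> 0 <= dot z w in
  let P3 := forall w, dom_graph_deriv_subdiff f xb vzero w ->
              exists z, graph_deriv_subdiff f xb vzero w z /\ 0 <= dot z w in
  let P4 := forall w, crit_cone Dg q Theta xb w ->
              (* the maximum over Lambda(xb) exists and is >= 0 *)
              exists lam, Lambda Dg q Dq Theta xb lam /\
                0 <= soc_value D2g q Dq D2q Dh D2h xb lam w /\
                forall lam', Lambda Dg q Dq Theta xb lam' ->
                  soc_value D2g q Dq D2q Dh D2h xb lam' w <=
                  soc_value D2g q Dq D2q Dh D2h xb lam w in
  (P1 -> P2) /\ (P2 <-> P3) /\ (P3 <-> P4).
Proof.
move=> f P1 P2 P3 P4.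
have Hh2b k : frechet (fun z => Dh z k) (q xb) (D2h (q xb) k) by apply: Hh2.
have [B HB] := exists_right_inverse (Dh (q xb)) Hsurj.
have [L [r1 [L0 r10 hL]]] := local_surjection _ _ h Dh (D2h (q xb)) V (q xb) B HVo HVy Hh1 Hh2b HB.
have [kappa [kappa0 [r2 [r20 hMS]]]] := HMSCQ.
have [r3 [r30 hV]] := HVo _ HVy.
(* [q] maps this ball both into [V] and into the ball around [q xb] on which local surjectivity of
   [h] holds. *)
have [r4 [r40 hq]] := frechet_near q xb _ _ (Hq1 xb) (Rmin_pos _ _ r10 r30).
pose rad := Rmin r1 (Rmin r2 r4).
have rad0 : 0 < rad by do 2![apply: Rmin_pos => //].
have rad1 : rad <= r1 := Rmin_l _ _.
have rad2 : rad <= r2 := Rle_trans _ _ _ (Rmin_r _ _) (Rmin_l _ _).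
have rad4 : rad <= r4 := Rle_trans _ _ _ (Rmin_r _ _) (Rmin_r _ _).
have near x : vnorm (vsub x xb) < rad -> V (q x) /\ vnorm (vsub (q x) (q xb)) < r1.
  move=> hx; have := hq x ltac:(lra) => h1; split.
    by apply: hV; apply: Rlt_le_trans h1 (Rmin_r _ _).
  exact: Rlt_le_trans h1 (Rmin_l _ _).
pose G x := h (q x).
pose DG := comp_jac n m l q Dq Dh.
pose D2G := comp_hess n m l q Dq (D2q xb) Dh (D2h (q xb)) xb.
pose Gam := Gamma q Theta.
have fE y a : f y = Some a <-> Gam y /\ a = g y := fobjP g q Theta y a.
have HG1 x : vnorm (vsub x xb) < rad -> forall i, hder (fun y => G y i) x (DG x i).
  by move=> /near [Vx _] i; apply: comp_jac_hder => //; apply: Hh1.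
have HG2 i a : hder (fun x => DG x i a) xb (D2G i a) by apply: comp_hess_hder.
have GamC x : vnorm (vsub x xb) < rad -> (Gam x <-> C (G x)).
  by move=> /near [Vx _]; apply: Hred.
have Gamcl : is_closed Gam.
  move=> u x hu /seq_convP cu; apply: (HTcl (fun k => q (u k))) => //.
  by apply/seq_convP; apply: frechet_cont cu.
have MS y c : vnorm (vsub y xb) < rad -> C c -> vnorm (vsub (G y) c) < rad ->
    forall eps, 0 < eps -> exists y', Gam y' /\
      vnorm (vsub y y') < kappa * L * vnorm (vsub (G y) c) + eps.
  move=> hy Cc hc eps e0; have [_ ny] := near y hy.
  (* Solving [h v = c] gives a point of [Theta] within [L |G y - c|] of [q y], which bounds the
     distance on the right of MSCQ. *)
  have [v [Vv hv nv]] := hL (q y) c ny ltac:(rewrite -/(G y); lra).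
  have Tv : Theta v by apply/Hred => //; rewrite hv.
  have [_ /(_ _ e0) [y' [Gy' hy']]] := dist_setP Gam y (ex_intro _ xb Hxb).
  exists y'; split=> //; apply: Rlt_le_trans hy' _; apply: Rplus_le_compat_r.
  apply: Rle_trans (hMS y ltac:(lra)) _; rewrite Rmult_assoc; apply: Rmult_le_compat_l; first lra.
  apply: Rle_trans (proj1 (dist_setP Theta (q y) HTne) v Tv) _.
  by rewrite vnorm_subC.
have kap0 : 0 < kappa * L by nra.
pose M := multiplier n l Dg DG C xb.
pose Q mu w := qform (hessM n l (D2g xb) D2G mu) w.
have LamM lam : Lambda Dg q Dq Theta xb lam -> exists mu, M mu /\ lam = mtv (Dh (q xb)) mu.
  move=> [hN hst].
  have [mu [hmu e]] := polar_of_normal m l h Dh (D2h (q xb)) Theta V C (q xb) Hxb HVo HVy Hh1 Hh2b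
    Hh0 Hsurj Hred HCcone lam hN.
  by exists mu; split=> //; split=> //; rewrite mtv_comp_jac e.
have MLam mu : M mu -> Lambda Dg q Dq Theta xb (mtv (Dh (q xb)) mu).
  move=> [hmu hst]; split; last by rewrite -(mtv_comp_jac n m l q Dq Dh xb).
  by apply: (normal_of_polar m l h Dh Theta V C (q xb)).
have socE mu w : soc_value D2g q Dq D2q Dh D2h xb (mtv (Dh (q xb)) mu) w = Q mu w.
  exact: soc_value_reduced.
have [lam0 /LamM [nu0 [hnu0 _]]] := Hstat.
have graph w z : graph_deriv_subdiff f xb vzero w z -> exists mu,
    [/\ M mu, crit_cone Dg q Theta xb w, dot z w = Q mu w,
        forall nu, M nu -> Q nu w <= Q mu w & P1 -> 0 <= dot z w].
  move=> hz.
  have [mu [h1 h2 h3 h4 h5]] := graph_deriv_multiplier n l g Dg (D2g xb) Gam f G DG D2G C xb rad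
    (kappa * L) fE rad0 kap0 Hg1 (Hg2 xb) HG1 HG2 Hh0 GamC HCcl HCcv HCcone MS w z hz.
  by exists mu; split=> // -[_ [del [d0 hmin]]]; apply: h5 d0 hmin.
have dom w : crit_cone Dg q Theta xb w -> exists z, graph_deriv_subdiff f xb vzero w z.
  exact: (critical_dom n l g Dg (D2g xb) Gam f G DG D2G C xb rad (kappa * L) fE rad0 kap0 Hg1
    (Hg2 xb) HG1 HG2 Hh0 GamC Hxb Gamcl HCcl HCcv HCcone MS nu0 w hnu0).
have P23 : P2 -> P3.
  by move=> h2 w [z hz]; exists z; split=> //; apply: h2 => //; exists z.
have P34 : P3 -> P4.
  move=> h3 w /dom /h3 [z [/graph [mu [hmu _ e hmax _]] z0]].
  exists (mtv (Dh (q xb)) mu); rewrite socE -e; split; first exact: MLam.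
  by split=> // lam' /LamM [nu [hnu ->]]; rewrite socE e; apply: hmax.
have P42 : P4 -> P2.
  move=> h4 w z _ /graph [mu [hmu hw e hmax _]].
  (* [<z, w>] is the largest [Q nu w], so it dominates the nonnegative value supplied by [P4]. *)
  have [_ [/LamM [nu [hnu ->]] [+ _]]] := h4 w hw.
  by rewrite socE e; have := hmax _ hnu; lra.
split; first by move=> h1 w z _ /graph [mu [_ _ _ _]]; apply.
by split; split=> // hP; [apply/P42/P34 | apply/P23/P42].
Qed.
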